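(* Let $\Omega_1,\Omega_2\subset\mathbb{C}^d$ be bounded convex domains with $C^{1,\alpha}$ boundaries (for some $\alpha\in(0,1]$). If $\Omega_2$ is $\mathbb{C}$-strictly convex, then every biholomorphism $f:\Omega_1\to\Omega_2$ extends to a continuous map $\overline f:\overline{\Omega_1}\to\overline{\Omega_2}$.
   Context: A convex domain $\Omega$ is $\mathbb{C}$-strictly convex if every supporting complex hyperplane intersects $\partial\Omega$ at exactly one point; when $\partial\Omega$ is $C^1$ this is equivalent to $T_x^{\mathbb{C}}\partial\Omega\cap\partial\Omega=\{x\}$ for every $x\in\partial\Omega$, where $T_x^{\mathbb{C}}\partial\Omega$ is the complex affine hyperplane tangent to $\partial\Omega$ at $x$. *)

(* Defs.v *)
From HB Require Import structures.
From mathcomp Require Export all_boot all_order all_algebra.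
From mathcomp Require Export all_classical all_reals all_analysis.
From mathcomp.real_closed Require Export complex.

Set Implicit Arguments.
Unset Strict Implicit.
Unset Printing Implicit Defensive.

Import Order.TTheory GRing.Theory Num.Theory.
Import numFieldNormedType.Exports.

Local Open Scope classical_set_scope.
Local Open Scope complex_scope.
Local Open Scope ring_scope.

(* R[i] as a normed module over itself, with norm `|z| = (sqrt (Re^2 + Im^2))%:C.
   C^d is then 'rV[R[i]]_d, with the sup norm. *)
HB.instance Definition _ (R : rcfType) := NormedModule.copy R[i] R[i]^o.

Definition boundary (T : topologicalType) (A : set T) : set T :=
  closure A `\` interior A.

(* convex_set is convexity over R[i]; since x <= y in R[i] forces y - x to be
   real, its coefficients range over the real interval [0, 1]. *)
Definition bounded_convex_domain (R : realType) (d : nat)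
    (Om : set 'rV[R[i]]_d) : Prop :=
  [/\ Om !=set0, open Om, convex_set Om & bounded_set Om].

(* The standard identification of R^d x R^d with C^d, (x, y) |-> x + iy; it is
   used to express real differentiability of functions on C^d. *)
Definition cvec (R : realType) (d : nat) (p : 'rV[R]_d * 'rV[R]_d) :
    'rV[R[i]]_d :=
  \row_j (p.1 0 j +i* p.2 0 j).

Definition C1holder_on (R : realType) (d : nat) (alpha : R)
    (U : set 'rV[R[i]]_d) (r : 'rV[R[i]]_d -> R) : Prop :=
  (forall p, U (cvec p) -> differentiable (r \o @cvec R d) p) /\
  exists M : R, forall p q v, U (cvec p) -> U (cvec q) ->
    `|'d (r \o @cvec R d) p v - 'd (r \o @cvec R d) q v|
      <= M * `|p - q| `^ alpha * `|v|.

(* C^{1,alpha} boundary: near each boundary point, Om has a C^{1,alpha}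
   defining function without critical points. *)
Definition C1holder_boundary (R : realType) (d : nat) (alpha : R)
    (Om : set 'rV[R[i]]_d) : Prop :=
  forall x, boundary Om x ->
    exists (U : set 'rV[R[i]]_d) (r : 'rV[R[i]]_d -> R),
      [/\ open U /\ U x,
          C1holder_on alpha U r,
          forall z, U z -> (Om z <-> r z < 0),
          forall z, U z -> (boundary Om z <-> r z = 0) &
          forall p, U (cvec p) -> exists v, 'd (r \o @cvec R d) p v != 0].

Definition complex_hyperplane (R : realType) (d : nat)
    (H : set 'rV[R[i]]_d) : Prop :=
  exists (a : 'rV[R[i]]_d) (c : R[i]),
    a != 0 /\ H = [set z | \sum_(j < d) a 0 j * z 0 j = c].

Definition supporting_complex_hyperplane (R : realType) (d : nat)
    (Om H : set 'rV[R[i]]_d) : Prop :=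
  [/\ complex_hyperplane H, H `&` boundary Om !=set0 & H `&` Om = set0].

Definition C_strictly_convex (R : realType) (d : nat)
    (Om : set 'rV[R[i]]_d) : Prop :=
  forall H, supporting_complex_hyperplane Om H ->
    exists x, H `&` boundary Om = [set x].

(* differentiable is taken over the scalar field R[i]. *)
Definition holomorphic_on (R : realType) (d e : nat) (Om : set 'rV[R[i]]_d)
    (f : 'rV[R[i]]_d -> 'rV[R[i]]_e) : Prop :=
  forall z, Om z -> differentiable f z.

(* Only the values of f on Om1 matter. *)
Definition biholomorphism (R : realType) (d : nat)
    (Om1 Om2 : set 'rV[R[i]]_d) (f : 'rV[R[i]]_d -> 'rV[R[i]]_d) : Prop :=
  [/\ holomorphic_on Om1 f, set_bij Om1 Om2 f &
      exists2 g : 'rV[R[i]]_d -> 'rV[R[i]]_d,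
        holomorphic_on Om2 g & forall z, Om1 z -> g (f z) = z].

(* Main.v *)
(* Fix a boundary point x of Om1.  If p in Om1 is close to x and r is a
   C^{1,al} defining function, a C^{1,al} bend of the half-plane gives a
   holomorphic disc in Om1 that contains p at distance s ~ - r p from the
   boundary of the disc and is centred at a point tau p t at depth t.  By the
   Schwarz lemma every holomorphic h from Om1 to the right half-plane satisfies
   |h (tau p t)| <= 2 t / s * |h p|.  Applied on Om2 to a supporting functional
   of Om1 composed with f^-1, this is a Hopf lemma: f p is at depth O(s).
   Applied on Om1 to a supporting functional of Om2 at a boundary point near
   f p, composed with f, it then gives |h (tau p t)| = O(t).  Letting p tend to
   x along a filter for which f p tends to y, the complex supporting functional
   of Om2 at y has size O(t) at f (tau x t).  By C-strict convexity every cluster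
   point of f (tau x t) as t tends to 0 is y; as tau does not depend on y, the
   map f has only one cluster value at x. *)
Require Import Defs.
From mathcomp Require Import ring lra.

Set Implicit Arguments.
Unset Strict Implicit.
Unset Printing Implicit Defensive.

Import Order.TTheory GRing.Theory Num.Theory.
Import numFieldNormedType.Exports.

Local Open Scope classical_set_scope.
Local Open Scope complex_scope.
Local Open Scope ring_scope.

Local Notation Re := (@complex.Re _).
Local Notation Im := (@complex.Im _).

(** * Goursat theorem on rectangles *)

(** The growth factor [2 t / s] blows up as [s] tends to 0, so the final bound O(t) survives only if
    [|h p|] is of the exact order [s]. This dictates both ingredients. The disc must give growth
    linear in [1 / s]: a cone would give a worse power, and for [al < 1] a tangent round disc need
    not fit, whence the bend [w - K w^(1 + al)], which absorbs the Taylor error of a C^{1,al}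
    defining function. The Hopf lemma must give depth O(s) at [f p] with no loss. The functional
    supporting [Om2] at [y] itself is useless at [f p], since [f p - y] need not be O(s); it is
    replaced by the one at a boundary point [b] at distance O(s) from [f p], and [b] tends to [y]
    only once the estimate is made. The modulus of the functional is controlled, not just its real
    part: limit points then lie in the complex tangent hyperplane, which is what complex strictness
    can exploit. Holomorphy is bare complex differentiability, so the one-variable theory starts
    from Goursat; it is phrased with real primitives, so that no complex line integral occurs. *)

(** A rectangle violating [P] has a quarter violating [P]; the nested quarters shrink to a point,
    where the local hypothesis is contradicted. *)
Lemma quadrisection (R : realType) (P : R -> R -> R -> R -> Prop) (a0 b0 c0 d0 : R) :
  a0 <= b0 -> c0 <= d0 ->
  (forall a b c d, a <= b -> c <= d ->
    let m := (a + b) / 2 in let n := (c + d) / 2 in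
    P a m c n -> P m b c n -> P a m n d -> P m b n d -> P a b c d) ->
  (forall x y, a0 <= x <= b0 -> c0 <= y <= d0 -> exists2 e, 0 < e &
    forall a b c d, a0 <= a <= x -> x <= b <= b0 -> c0 <= c <= y -> y <= d <= d0 ->
      b - a <= e -> d - c <= e -> P a b c d) ->
  P a0 b0 c0 d0.
Proof.
move=> ab0 cd0 Psplit Ploc; apply: contrapT => NP0.
pose Q (q : R * R * R * R) := P q.1.1.1 q.1.1.2 q.1.2 q.2.
pose wf (q : R * R * R * R) := q.1.1.1 <= q.1.1.2 /\ q.1.2 <= q.2.
pose sub (p q : R * R * R * R) :=
  [/\ p.1.1.1 <= q.1.1.1, q.1.1.2 <= p.1.1.2, p.1.2 <= q.1.2, q.2 <= p.2 &
    q.1.1.2 - q.1.1.1 = (p.1.1.2 - p.1.1.1) / 2 /\ q.2 - q.1.2 = (p.2 - p.1.2) / 2].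
(* The bad quarter is chosen inside a sigma type, so that the choice can be iterated. *)
have step (p : {q | wf q /\ ~ Q q}) : {q : {q | wf q /\ ~ Q q} | sub (sval p) (sval q)}.
  apply: cid; case: p => -[[[a b] c] d] /= [[/= ab cd] NQ].
  apply: contrapT => Nex; apply: NQ; rewrite /Q /=.
  apply: Psplit => //; apply: contrapT => N; apply: Nex.
  - have W : wf (a, (a + b) / 2, c, (c + d) / 2) /\ ~ Q (a, (a + b) / 2, c, (c + d) / 2).
      by split=> //; split=> /=; lra.
    by exists (exist (fun q => wf q /\ ~ Q q) _ W); split=> /=; lra.
  - have W : wf ((a + b) / 2, b, c, (c + d) / 2) /\ ~ Q ((a + b) / 2, b, c, (c + d) / 2).
      by split=> //; split=> /=; lra.
    by exists (exist (fun q => wf q /\ ~ Q q) _ W); split=> /=; lra.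
  - have W : wf (a, (a + b) / 2, (c + d) / 2, d) /\ ~ Q (a, (a + b) / 2, (c + d) / 2, d).
      by split=> //; split=> /=; lra.
    by exists (exist (fun q => wf q /\ ~ Q q) _ W); split=> /=; lra.
  - have W : wf ((a + b) / 2, b, (c + d) / 2, d) /\ ~ Q ((a + b) / 2, b, (c + d) / 2, d).
      by split=> //; split=> /=; lra.
    by exists (exist (fun q => wf q /\ ~ Q q) _ W); split=> /=; lra.
have W0 : wf (a0, b0, c0, d0) /\ ~ Q (a0, b0, c0, d0) by [].
pose s n := sval (iter n (fun p => sval (step p)) (exist (fun q => wf q /\ ~ Q q) _ W0)).
have sP n : wf (s n) /\ ~ Q (s n) by rewrite /s; case: (iter n _ _).
have sS n : sub (s n) (s n.+1).
  by rewrite /s iterS; case: (step _).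
have mono n k : [/\ (s n).1.1.1 <= (s (n + k)%N).1.1.1, (s (n + k)%N).1.1.2 <= (s n).1.1.2,
    (s n).1.2 <= (s (n + k)%N).1.2 & (s (n + k)%N).2 <= (s n).2].
  elim: k => [|k [h1 h2 h3 h4]]; first by rewrite addn0; split.
  rewrite addnS; have [k1 k2 k3 k4 _] := sS (n + k)%N.
  by split; [exact: le_trans h1 _|exact: le_trans _ h2|exact: le_trans h3 _|exact: le_trans _ h4].
have len n : (s n).1.1.2 - (s n).1.1.1 = (b0 - a0) / 2 ^+ n /\
             (s n).2 - (s n).1.2 = (d0 - c0) / 2 ^+ n.
  elim: n => [|n [h1 h2]]; first by rewrite expr0 !divr1.
  have [_ _ _ _ [-> ->]] := sS n; rewrite h1 h2 exprS invfM.
  by split; rewrite [RHS]mulrA [RHS]mulrAC.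
have cross m n : (s m).1.1.1 <= (s n).1.1.2 /\ (s m).1.2 <= (s n).2.
  have [h1 _ h3 _] := mono m n; have [_ k2 _ k4] := mono n m.
  have [[w1 w2] _] := sP (m + n)%N.
  by rewrite addnC in k2 k4; split; lra.
(* Every left edge is at most every right edge, and likewise for lower and upper edges; hence the
   suprema of the left and of the lower edges give a point common to all rectangles. *)
pose X := range (fun n => (s n).1.1.1); pose Y := range (fun n => (s n).1.2).
have Xs : X !=set0 by exists (s 0%N).1.1.1; exists 0%N.
have Ys : Y !=set0 by exists (s 0%N).1.2; exists 0%N.
have Xu n : ubound X (s n).1.1.2 by move=> _ [m _ <-]; have [] := cross m n.
have Yu n : ubound Y (s n).2 by move=> _ [m _ <-]; have [] := cross m n.
have Xl n : (s n).1.1.1 <= sup X.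
  by apply: ub_le_sup; [exists (s 0%N).1.1.2; exact: Xu|exists n].
have Yl n : (s n).1.2 <= sup Y.
  by apply: ub_le_sup; [exists (s 0%N).2; exact: Yu|exists n].
have Xr n : sup X <= (s n).1.1.2 by apply: ge_sup.
have Yr n : sup Y <= (s n).2 by apply: ge_sup.
have [||e e0 He] := Ploc (sup X) (sup Y).
- by rewrite (Xl 0%N) (Xr 0%N).
- by rewrite (Yl 0%N) (Yr 0%N).
pose M := (b0 - a0) + (d0 - c0).
have [n Hn] : exists n, M / 2 ^+ n <= e.
  exists (Num.bound (M / e)).
  rewrite ler_pdivrMr ?exprn_gt0// mulrC -ler_pdivrMr//.
  have M0 : 0 <= M / e by apply: divr_ge0; [rewrite /M; lra|exact: ltW].
  by apply: ltW; exact: upper_nthrootP.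
have [_ NQ] := sP n; apply: NQ; have [l1 l2] := len n.
have [m1 m2 m3 m4] := mono 0%N n; rewrite add0n /= in m1 m2 m3 m4.
have hM : (b0 - a0) / 2 ^+ n <= M / 2 ^+ n /\ (d0 - c0) / 2 ^+ n <= M / 2 ^+ n.
  by rewrite !ler_pM2r ?invr_gt0 ?exprn_gt0//; rewrite /M; split; lra.
by apply: He; rewrite ?Xl ?Xr ?Yl ?Yr ?m1 ?m2 ?m3 ?m4 ?l1 ?l2//; lra.
Qed.

Lemma continuous_primitive (R : realType) (g : R -> R) (a b : R) :
  (forall x, a <= x <= b -> {for x, continuous g}) ->
  exists G : R -> R, forall x, a < x < b -> is_derive x 1 G (g x).
Proof.
move=> gc.
pose mu := (@lebesgue_measure R).
exists (fun x => \int[mu]_(t in `[a, x]) g t).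
move=> x /andP[ax xb].
have gi : mu.-integrable `[a, b] (EFin \o g).
  apply: continuous_compact_integrable; first exact: segment_compact.
  apply: continuous_in_subspaceT => y; rewrite inE /= in_itv /= => yab; exact: gc.
have gx : {for x, continuous g} by apply: gc; rewrite !ltW.
have [d1 d2] := continuous_FTC1_closed xb gi ax gx.
by apply: DeriveDef; [exact: d1|rewrite -derive1E; exact: d2].
Qed.

(** A form without quotients, in which the increment may vanish; real and complex derivatives are
    compared through it. *)
Lemma is_derive_epsP (K : numFieldType) (W : normedModType K) (f : K -> W) (z : K) (l : W) :
  is_derive z 1 f l <->
  forall e, 0 < e -> \forall w \near z, `|f w - f z - (w - z) *: l| <= e * `|w - z|.
Proof.
split=> [[fd fl] e e0|H].
  have cvgl : h^-1 *: ((f \o shift z) (h *: 1) - f z) @[h --> 0^'] --> l.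
    by rewrite -fl; exact: fd.
  move/cvgrPdist_le : cvgl => /(_ e e0) /nbhs_normP[d /= d0 Hd].
  apply/nbhs_normP; exists d => //= w /= wd.
  have [->|wz] := eqVneq w z; first by rewrite !subrr scale0r subrr !normr0 mulr0.
  have wz0 : w - z != 0 by rewrite subr_eq0.
  have wd' : `|0 - (w - z)| < d by rewrite sub0r normrN distrC.
  have := Hd (w - z) wd' wz0.
  rewrite /= /shift /= [(w - z) *: 1]mulr1 subrK => h.
  have -> : f w - f z - (w - z) *: l = (w - z) *: ((w - z)^-1 *: (f w - f z) - l).
    by rewrite scalerBr scalerA divff// scale1r.
  rewrite normrZ [leLHS]mulrC; apply: ler_wpM2r => //.
  by rewrite distrC.
have cvgl : h^-1 *: ((f \o shift z) (h *: 1) - f z) @[h --> 0^'] --> l.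
  apply/cvgrPdist_le => e e0; have /nbhs_normP[d /= d0 Hd] := H e e0.
  apply/nbhs_normP; exists d => //= h /=; rewrite sub0r normrN => hd h0.
  have := Hd (h + z); rewrite /= opprD addrCA subrr addr0 normrN => /(_ hd).
  rewrite /= /shift /= [h *: 1]mulr1 addrK => k.
  have -> : l - h^-1 *: (f (h + z) - f z) = - (h^-1 *: (f (h + z) - f z - h *: l)).
    by rewrite [in RHS]scalerBr scalerA mulVf// scale1r opprB.
  rewrite normrN normrZ normfV mulrC ler_pdivrMr ?normr_gt0//.
apply: DeriveDef; first by apply/cvg_ex; exists l.
exact: cvg_lim cvgl.
Qed.

(** The norm of a space over [R[i]] takes values in the partially ordered field [R[i]]; its real
    part carries the same information in the totally ordered field [R]. *)
Definition cnorm (R : rcfType) (V : normedZmodType R[i]) (v : V) : R := Re `|v|.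

Section cnorm_theory.
Variables (R : rcfType) (V : normedZmodType R[i]).
Implicit Types v w : V.

Lemma cnormE v : `|v| = (cnorm v)%:C.
Proof. by rewrite /cnorm RRe_real// normr_real. Qed.

Lemma cnorm_ge0 v : 0 <= cnorm v.
Proof. by rewrite -lecR -cnormE; exact: (normr_ge0 v). Qed.

Lemma cnormD v w : cnorm (v + w) <= cnorm v + cnorm w.
Proof. by rewrite -lecR rmorphD/= -!cnormE ler_normD. Qed.

Lemma cnormN v : cnorm (- v) = cnorm v.
Proof. by rewrite /cnorm normrN. Qed.

Lemma cdistrC v w : cnorm (v - w) = cnorm (w - v).
Proof. by rewrite -cnormN opprB. Qed.

Lemma cnormB v w : cnorm (v - w) <= cnorm v + cnorm w.
Proof. by rewrite (le_trans (cnormD _ _))// cnormN. Qed.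

Lemma cnormBr v w : cnorm v - cnorm w <= cnorm (v - w).
Proof. by rewrite lerBlDr (le_trans _ (cnormD _ _))// subrK. Qed.

Lemma cnorm0 : cnorm (0 : V) = 0.
Proof. by rewrite /cnorm normr0. Qed.

Lemma cnorm_eq0 v : (cnorm v == 0) = (v == 0).
Proof.
apply/eqP/eqP => [h|->]; last exact: cnorm0.
by apply/eqP; rewrite -normr_eq0 cnormE h.
Qed.

Lemma cnorm_gt0 v : (0 < cnorm v) = (v != 0).
Proof. by rewrite lt_def cnorm_eq0 cnorm_ge0 andbT. Qed.

End cnorm_theory.

Section cmodulus.
Variable R : rcfType.
Implicit Types (z w : R[i]) (x : R).

Lemma cnormM z w : cnorm (z * w) = cnorm z * cnorm w.
Proof. by apply/complexI; rewrite rmorphM/= -!cnormE normrM. Qed.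

Lemma cnormV z : cnorm z^-1 = (cnorm z)^-1.
Proof. by apply/complexI; rewrite fmorphV/= -!cnormE normfV. Qed.

Lemma cnormf z w : cnorm (z / w) = cnorm z / cnorm w.
Proof. by rewrite cnormM cnormV. Qed.

Lemma cnorm_def z : cnorm z = Num.sqrt (Re z ^+ 2 + Im z ^+ 2).
Proof. by rewrite /cnorm normc_def. Qed.

Lemma cnorm_sqr z : cnorm z ^+ 2 = Re z ^+ 2 + Im z ^+ 2.
Proof. by rewrite cnorm_def sqr_sqrtr// addr_ge0// sqr_ge0. Qed.

Lemma cnorm_real x : cnorm x%:C = `|x|.
Proof. by rewrite cnorm_def/= expr0n/= addr0 sqrtr_sqr. Qed.

Lemma Re_le_cnorm z : `|Re z| <= cnorm z.
Proof. by rewrite cnorm_def -sqrtr_sqr ler_wsqrtr// lerDl sqr_ge0. Qed.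

Lemma Im_le_cnorm z : `|Im z| <= cnorm z.
Proof. by rewrite cnorm_def -sqrtr_sqr ler_wsqrtr// lerDr sqr_ge0. Qed.

Lemma cnorm_le_ReIm z : cnorm z <= `|Re z| + `|Im z|.
Proof.
rewrite -(ler_pXn2r (n := 2))// ?nnegrE ?addr_ge0 ?cnorm_ge0//.
rewrite cnorm_sqr sqrrD !real_normK ?num_real// lerD2r lerDl.
by rewrite mulrn_wge0// mulr_ge0.
Qed.

Lemma cnormJ z : cnorm z^* = cnorm z.
Proof. by rewrite /cnorm normcJ. Qed.

Lemma cReM z w : Re (z * w) = Re z * Re w - Im z * Im w.
Proof. by case: z w => [a b] [c d]. Qed.

Lemma cImM z w : Im (z * w) = Re z * Im w + Im z * Re w.
Proof. by case: z w => [a b] [c d]. Qed.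

Lemma cReD z w : Re (z + w) = Re z + Re w.
Proof. by case: z w => [a b] [c d]. Qed.

Lemma cImD z w : Im (z + w) = Im z + Im w.
Proof. by case: z w => [a b] [c d]. Qed.

Lemma cReN z : Re (- z) = - Re z. Proof. by case: z. Qed.

Lemma cImN z : Im (- z) = - Im z. Proof. by case: z. Qed.

Lemma cReB z w : Re (z - w) = Re z - Re w.
Proof. by rewrite cReD cReN. Qed.

Lemma cImB z w : Im (z - w) = Im z - Im w.
Proof. by rewrite cImD cImN. Qed.

Lemma complex_eq z w : Re z = Re w -> Im z = Im w -> z = w.
Proof. by case: z w => [a b] [c d] /= -> ->. Qed.

End cmodulus.

Lemma cnormZ (R : rcfType) (V : normedModType R[i]) (a : R[i]) (v : V) :
  cnorm (a *: v) = cnorm a * cnorm v.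
Proof. by apply/complexI; rewrite rmorphM/= -!cnormE normrZ. Qed.

Lemma nbhs_cnormP (R : rcfType) (V : normedModType R[i]) (v : V) (P : set V) :
  nbhs v P <-> exists2 e : R, 0 < e & forall w, cnorm (w - v) < e -> P w.
Proof.
split=> [/nbhs_normP[e /= e0 H]|[e e0 H]].
  have eE : e = (Re e)%:C by rewrite RRe_real// gtr0_real.
  exists (Re e); first by rewrite -ltcR -eE.
  by move=> w wv; apply: H => /=; rewrite distrC cnormE eE ltcR.
apply/nbhs_normP; exists e%:C => /=; first by rewrite -[0]/(0%:C) ltcR.
by move=> w /=; rewrite distrC cnormE ltcR; exact: H.
Qed.

Lemma cderiv_epsP (R : rcfType) (f : R[i] -> R[i]) (z l : R[i]) :
  is_derive z 1 f l <->
  forall e : R, 0 < e -> exists2 d : R, 0 < d &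
    forall w, cnorm (w - z) < d -> cnorm (f w - f z - l * (w - z)) <= e * cnorm (w - z).
Proof.
rewrite is_derive_epsP; split=> H e e0.
  have e0' : 0 < e%:C :> R[i] by rewrite -[0]/(0%:C) ltcR.
  have /nbhs_cnormP[d d0 Hd] := H _ e0'; exists d => // w /Hd.
  by rewrite !cnormE -rmorphM lecR [l * _]mulrC.
have eE : e = (Re e)%:C by rewrite RRe_real// gtr0_real.
have e0' : 0 < Re e by rewrite -ltcR -eE.
have [d d0 Hd] := H _ e0'; apply/nbhs_cnormP; exists d => // w /Hd.
by rewrite eE !cnormE -rmorphM lecR [l * _]mulrC.
Qed.

(** With [F y] a primitive of [Im K] along horizontal lines and [G x] one of [Re K] along vertical
    lines, the left-hand side is the imaginary part of the integral of [K dz] around the rectangle,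
    counterclockwise. Increments of given primitives replace integrals. *)
Lemma goursat (R : realType) (K : R[i] -> R[i]) (F G : R -> R -> R) (a b c d : R) :
  a <= b -> c <= d ->
  (forall x y, a <= x <= b -> c <= y <= d ->
    [/\ derivable K (x +i* y) 1,
        is_derive x 1 (F y) (Im (K (x +i* y))) &
        is_derive y 1 (G x) (Re (K (x +i* y)))]) ->
  F c b - F c a + (G b d - G b c) - (F d b - F d a) - (G a d - G a c) = 0.
Proof.
move=> ab cd H.
pose J a b c d := F c b - F c a + (G b d - G b c) - (F d b - F d a) - (G a d - G a c).
rewrite -/(J a b c d).
suff Je e : 0 < e -> `|J a b c d| <= e * ((b - a) + (d - c)) ^+ 2.
  apply/eqP; rewrite -normr_le0; apply/ler_addgt0Pl => e e0; rewrite addr0.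
  set l := (b - a) + (d - c); have l0 : 0 <= l by rewrite /l; lra.
  apply: le_trans (Je (e / (l ^+ 2 + 1)) _) _.
    by rewrite divr_gt0// ltr_wpDl ?sqr_ge0.
  have l2 : 0 < l ^+ 2 + 1 by rewrite ltr_wpDl ?sqr_ge0.
  by rewrite mulrAC ler_pdivrMr// -/l ler_pM2l// lerDl.
move=> e0.
(* The bound is quadratic in the half-perimeter: each quarter has half of it, so the four bounds add
   up exactly to the bound for the whole. *)
pose P a' b' c' d' := `|J a' b' c' d'| <= e * ((b' - a') + (d' - c')) ^+ 2.
apply: (@quadrisection R P a b c d) => //.
- move=> a' b' c' d' ab' cd' m n; rewrite /P => h1 h2 h3 h4.
  have -> : J a' b' c' d' = J a' m c' n + J m b' c' n + J a' m n d' + J m b' n d'.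
    by rewrite /J; ring.
  apply: le_trans (ler_normD _ _) _.
  apply: le_trans (lerD (ler_normD _ _) (lexx _)) _.
  apply: le_trans (lerD (lerD (ler_normD _ _) (lexx _)) (lexx _)) _.
  apply: le_trans (lerD (lerD (lerD h1 h2) h3) h4) _.
  rewrite le_eqVlt; apply/orP; left; apply/eqP; rewrite /m /n; by field.
- move=> x0 y0 x0ab y0cd.
  have [Kd _ _] := H _ _ x0ab y0cd.
  set z0 := x0 +i* y0 in Kd; pose L := 'D_1 K z0.
  have /cderiv_epsP HK : is_derive z0 1 K L by exact: DeriveDef.
  (* The tolerance is [e / 2] because each side length occurs twice in the perimeter. Sides of
     length at most [del / 4] keep the rectangle within [del] of [z0]. *)
  have [del del0 Hdel] := HK (e / 2) ltac:(lra).
  exists (del / 4); first by lra.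
  move=> a' b' c' d' ha hb hc hd dab dcd; rewrite /P.
  have ab' : a' <= b' by lra.
  have cd' : c' <= d' by lra.
  set l := (b' - a') + (d' - c').
  (* The affine part of K at z0 contributes nothing, since it has primitives. *)
  pose u (x y : R) : R := Im (K z0) + Im (L * ((x +i* y) - z0)).
  pose v (x y : R) : R := Re (K z0) + Re (L * ((x +i* y) - z0)).
  have uE (x y : R) : u x y = Im (K z0) + Re L * (y - y0) + Im L * (x - x0).
    by rewrite /u cImM cImB cReB /=; ring.
  have vE (x y : R) : v x y = Re (K z0) + Re L * (x - x0) - Im L * (y - y0).
    by rewrite /v cReM cImB cReB /=; ring.
  pose U (y x : R) : R := (Im (K z0) + Re L * (y - y0)) * x + Im L * ((x - x0) ^+ 2 / 2).
  pose V (x y : R) : R := (Re (K z0) + Re L * (x - x0)) * y - Im L * ((y - y0) ^+ 2 / 2).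
  have Ud (y x : R) : is_derive x 1 (U y) (u x y).
    rewrite uE /U; apply: is_derive_eq; rewrite -![_ *: _]/(_ * _); by field.
  have Vd (x y : R) : is_derive y 1 (V x) (v x y).
    rewrite vE /V; apply: is_derive_eq; rewrite -![_ *: _]/(_ * _); by field.
  have near (x y : R) : a' <= x <= b' -> c' <= y <= d' ->
      cnorm (K (x +i* y) - K z0 - L * ((x +i* y) - z0)) <= e / 2 * l.
    move=> hx hy; have d1 : cnorm ((x +i* y) - z0) <= l.
      apply: le_trans (cnorm_le_ReIm _) _; rewrite cReB cImB /=.
      have : `|x - x0| <= b' - a' by rewrite ler_norml; lra.
      have : `|y - y0| <= d' - c' by rewrite ler_norml; lra.
      rewrite /l; lra.
    apply: le_trans (Hdel _ _) _.
      by apply: le_lt_trans d1 _; rewrite /l; lra.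
    by rewrite ler_pM2l//; lra.
  have near_u (x y : R) : a' <= x <= b' -> c' <= y <= d' -> `|Im (K (x +i* y)) - u x y| <= e / 2 * l.
    move=> hx hy; apply: le_trans _ (near x y hx hy); apply: le_trans _ (Im_le_cnorm _).
    by rewrite /u !cImB opprD addrA.
  have near_v (x y : R) : a' <= x <= b' -> c' <= y <= d' -> `|Re (K (x +i* y)) - v x y| <= e / 2 * l.
    move=> hx hy; apply: le_trans _ (near x y hx hy); apply: le_trans _ (Re_le_cnorm _).
    by rewrite /v !cReB opprD addrA.
  have mvt (f df : R -> R) (p q k : R) : p <= q -> (forall x, p <= x <= q -> is_derive x 1 f (df x)) ->
      (forall x, p <= x <= q -> `|df x| <= k) -> `|f q - f p| <= k * (q - p).
    move=> pq fd dfk; have [||r] := @MVT_segment R f df p q pq.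
    - move=> x /[!in_itv]/= hx; apply: fd; lra.
    - apply: derivable_within_continuous => x /[!in_itv]/= hx.
      by have [] := fd x hx.
    - rewrite in_itv/= => hr ->; rewrite normrM (ger0_norm (_ : 0 <= q - p)) ?subr_ge0//.
      by apply: ler_wpM2r; rewrite ?subr_ge0// dfk.
  have mF y : c' <= y <= d' ->
      `|(F y b' - U y b') - (F y a' - U y a')| <= e / 2 * l * (b' - a').
    move=> hy; apply: (mvt (fun x => F y x - U y x) (fun x => Im (K (x +i* y)) - u x y)).
    - exact: ab'.
    - move=> x hx; have [||_ Fd _] := H x y; [lra|lra|].
      exact: is_deriveB.
    - by move=> x hx; exact: near_u.
  have mG x : a' <= x <= b' ->
      `|(G x d' - V x d') - (G x c' - V x c')| <= e / 2 * l * (d' - c').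
    move=> hx; apply: (mvt (fun y => G x y - V x y) (fun y => Re (K (x +i* y)) - v x y)).
    - exact: cd'.
    - move=> y hy; have [||_ _ Gd] := H x y; [lra|lra|].
      exact: is_deriveB.
    - by move=> y hy; exact: near_v.
  have J0 : U c' b' - U c' a' + (V b' d' - V b' c') - (U d' b' - U d' a') - (V a' d' - V a' c') = 0.
    by rewrite /U /V; field.
  have -> : J a' b' c' d' =
      ((F c' b' - U c' b') - (F c' a' - U c' a')) + ((G b' d' - V b' d') - (G b' c' - V b' c'))
      - ((F d' b' - U d' b') - (F d' a' - U d' a')) - ((G a' d' - V a' d') - (G a' c' - V a' c')).
    by rewrite -[LHS]subr0 -J0 /J; ring.
  have m1 := mF c' ltac:(by rewrite lexx); have m2 := mF d' ltac:(by rewrite lexx andbT).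
  have m3 := mG a' ltac:(by rewrite lexx); have m4 := mG b' ltac:(by rewrite lexx andbT).
  apply: le_trans (ler_normB _ _) _.
  apply: le_trans (lerD (ler_normB _ _) (lexx _)) _.
  apply: le_trans (lerD (lerD (ler_normD _ _) (lexx _)) (lexx _)) _.
  apply: le_trans (lerD (lerD (lerD m1 m4) m2) m3) _.
  rewrite le_eqVlt; apply/orP; left; apply/eqP; rewrite /l; by field.
Qed.

(** * Complex exponential and the maximum principle at a center *)

Section complex_continuity.
Variable R : realType.

Lemma continuous_Re : continuous (fun z : R[i] => Re z).
Proof.
move=> z; apply/(@cvgrPdist_lt _ _ _ (nbhs z) (nbhs_filter z)) => e e0; apply/nbhs_cnormP; exists e => // w wz.
by rewrite -cReB; apply: le_lt_trans (Re_le_cnorm _) _; rewrite cdistrC.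
Qed.

Lemma continuous_Im : continuous (fun z : R[i] => Im z).
Proof.
move=> z; apply/(@cvgrPdist_lt _ _ _ (nbhs z) (nbhs_filter z)) => e e0; apply/nbhs_cnormP; exists e => // w wz.
by rewrite -cImB; apply: le_lt_trans (Im_le_cnorm _) _; rewrite cdistrC.
Qed.

Lemma continuous_horizontal (y : R) : continuous (fun x : R => x +i* y).
Proof.
move=> x A hA; have [e e0 H] := (nbhs_cnormP (x +i* y) A).1 hA; apply/nbhs_normP; exists e => //= x' /= xx'.
apply: H; apply: le_lt_trans (cnorm_le_ReIm _) _.
by rewrite cReB cImB/= subrr normr0 addr0 distrC.
Qed.

Lemma continuous_vertical (x : R) : continuous (fun y : R => x +i* y).
Proof.
move=> y A hA; have [e e0 H] := (nbhs_cnormP (x +i* y) A).1 hA; apply/nbhs_normP; exists e => //= y' /= yy'.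
apply: H; apply: le_lt_trans (cnorm_le_ReIm _) _.
by rewrite cReB cImB/= subrr normr0 add0r distrC.
Qed.

End complex_continuity.

Lemma cderiv_comp (R : realType) (f g : R[i] -> R[i]) (z a b : R[i]) :
  is_derive (g z) 1 f a -> is_derive z 1 g b -> is_derive z 1 (f \o g) (a * b).
Proof.
move=> /cderiv_epsP fd /cderiv_epsP gd; apply/cderiv_epsP => e e0.
have a0 : 0 <= cnorm a by exact: cnorm_ge0.
have b0 : 0 <= cnorm b by exact: cnorm_ge0.
(* Each of the two errors gets [e / 2]. The bound [e2 <= 1] makes [g] Lipschitz at [z] with constant
   [cnorm b + 1]. *)
pose e1 := e / 2 / (cnorm b + 1); pose e2 := Num.min 1 (e / 2 / (cnorm a + 1)).
have e10 : 0 < e1 by apply: divr_gt0; lra.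
have e20 : 0 < e2 by rewrite lt_min ltr01/=; apply: divr_gt0; lra.
have e21 : e2 <= 1 by rewrite ge_min lexx.
have ea : e2 * cnorm a <= e / 2.
  apply: (@le_trans _ _ (e / 2 / (cnorm a + 1) * (cnorm a + 1))); last first.
    by rewrite divfK//; apply: lt0r_neq0; lra.
  by apply: ler_pM => //; [exact: ltW|rewrite ge_min lexx orbT|lra].
have eb : e1 * (cnorm b + 1) = e / 2 by rewrite divfK//; apply: lt0r_neq0; lra.
have [d1 d10 H1] := fd e1 e10; have [d2 d20 H2] := gd e2 e20.
exists (Num.min d2 (d1 / (cnorm b + 1))).
  by rewrite lt_min d20/=; apply: divr_gt0; lra.
move=> w; rewrite lt_min => /andP[w2 w1].
have {}H2 := H2 w w2; set n := cnorm (w - z) in w1 w2 H2 *.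
have n0 : 0 <= n by exact: cnorm_ge0.
have gw : cnorm (g w - g z) <= (cnorm b + 1) * n.
  have -> : g w - g z = (g w - g z - b * (w - z)) + b * (w - z) by ring.
  apply: le_trans (cnormD _ _) _; rewrite cnormM -/n mulrDl mul1r addrC lerD2l.
  apply: le_trans H2 _; exact: ler_piMl.
have {}H1 : cnorm (f (g w) - f (g z) - a * (g w - g z)) <= e / 2 * n.
  apply: le_trans (H1 _ _) _.
    by apply: le_lt_trans gw _; rewrite mulrC -ltr_pdivlMr//; lra.
  by apply: le_trans (ler_wpM2l (ltW e10) gw) _; rewrite mulrA eb.
have -> : (f \o g) w - (f \o g) z - a * b * (w - z) =
  (f (g w) - f (g z) - a * (g w - g z)) + a * (g w - g z - b * (w - z)) by rewrite /=; ring.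
apply: le_trans (cnormD _ _) _; rewrite cnormM.
have : cnorm a * cnorm (g w - g z - b * (w - z)) <= e / 2 * n.
  apply: le_trans (ler_wpM2l a0 H2) _.
  by rewrite mulrA [cnorm a * e2]mulrC; apply: ler_wpM2r.
move: H1; clear; lra.
Qed.

Definition cexp (R : realType) (z : R[i]) : R[i] :=
  (expR (Re z) * cos (Im z)) +i* (expR (Re z) * sin (Im z)).

Section cexp_theory.
Variable R : realType.
Implicit Types z w : R[i].

Lemma cexpD z w : cexp (z + w) = cexp z * cexp w.
Proof.
apply: complex_eq; rewrite /cexp ?cReM ?cImM cReD cImD /= expRD ?cosD ?sinD; ring.
Qed.

Lemma cexp0 : cexp 0 = 1 :> R[i].
Proof. by rewrite /cexp/= expR0 cos0 sin0 mulr1 mulr0. Qed.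

Lemma cnorm_cexp z : cnorm (cexp z) = expR (Re z).
Proof.
rewrite cnorm_def /= !exprMn -mulrDr cos2Dsin2 mulr1 sqrtr_sqr.
by rewrite ger0_norm// expR_ge0.
Qed.

Lemma cexp_neq0 z : cexp z != 0.
Proof. by rewrite -cnorm_gt0 cnorm_cexp expR_gt0. Qed.

Lemma real_derive_eps (f : R -> R) (x l : R) : is_derive x 1 f l ->
  forall e, 0 < e -> exists2 d, 0 < d &
    forall y, `|y - x| < d -> `|f y - f x - l * (y - x)| <= e * `|y - x|.
Proof.
move=> /is_derive_epsP H e e0; have /nbhs_normP[d d0 Hd] := H e e0.
exists d => // y yx; have := Hd y; rewrite /= distrC => /(_ yx).
by rewrite [(y - x) *: l]mulrC.
Qed.

Lemma is_derive_cexp0 : is_derive (0 : R[i]) 1 (@cexp R) 1.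
Proof.
(* The real first-order errors of exp, cos and sin are at most [k * n], and the product terms are
   quadratic in [n], with [n <= k]. The total is at most [9 * (k * n)], hence the 16. *)
apply/cderiv_epsP => e e0; pose k := Num.min (e / 16) 1.
have k0 : 0 < k by rewrite lt_min ltr01 andbT; lra.
have [ke k1] : k <= e / 16 /\ k <= 1 by rewrite !ge_min !lexx orbT.
have [d1 d10 H1] := real_derive_eps (is_derive_expR 0) k0.
have [d2 d20 H2] := real_derive_eps (is_derive_cos 0) k0.
have [d3 d30 H3] := real_derive_eps (is_derive_sin 0) k0.
pose d := Num.min k (Num.min d1 (Num.min d2 d3)).
exists d; first by rewrite /d lt_min k0 lt_min d10 lt_min d20 d30.
move=> w; rewrite !subr0 cexp0 mul1r /d.
rewrite lt_min => /andP[wk]; rewrite lt_min => /andP[w1]; rewrite lt_min => /andP[w2 w3].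
have rw := Re_le_cnorm w; have iw := Im_le_cnorm w.
have := H1 (Re w); rewrite subr0 expR0 mul1r => /(_ (le_lt_trans rw w1)) {}H1.
have := H2 (Im w); rewrite subr0 cos0 sin0 oppr0 mul0r subr0 => /(_ (le_lt_trans iw w2)) {}H2.
have := H3 (Im w); rewrite subr0 cos0 sin0 subr0 mul1r => /(_ (le_lt_trans iw w3)) {}H3.
set n := cnorm w in wk rw iw *; set x := Re w in H1 rw *; set y := Im w in H2 H3 iw *.
have n0 : 0 <= n by exact: cnorm_ge0.
have B1 : `|expR x - 1 - x| <= k * n by apply: le_trans H1 _; rewrite ler_pM2l.
have B2 : `|cos y - 1| <= k * n by apply: le_trans H2 _; rewrite ler_pM2l.
have B3 : `|sin y - y| <= k * n by apply: le_trans H3 _; rewrite ler_pM2l.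
have kn : k * n <= n by apply: ler_piMl.
have E : `|expR x - 1| <= 2 * n.
  have -> : expR x - 1 = (expR x - 1 - x) + x by ring.
  apply: le_trans (ler_normD _ _) _; lra.
have S : `|sin y| <= 2 * n.
  have -> : sin y = (sin y - y) + y by ring.
  apply: le_trans (ler_normD _ _) _; lra.
have nk : n * n <= k * n by apply: ler_wpM2r => //; lra.
apply: le_trans (cnorm_le_ReIm _) _; rewrite !cReB !cImB /= -/x -/y subr0.
have R1 : `|expR x * cos y - 1 - x| <= 4 * (k * n).
  have -> : expR x * cos y - 1 - x =
     (expR x - 1) * (cos y - 1) + (cos y - 1) + (expR x - 1 - x) by ring.
  apply: le_trans (ler_normD _ _) _.
  apply: le_trans (lerD (ler_normD _ _) (lexx _)) _.
  rewrite normrM.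
  have : `|expR x - 1| * `|cos y - 1| <= (2 * n) * (k * n) by apply: ler_pM.
  have : (2 * n) * (k * n) <= 2 * (k * n).
    by apply: ler_wpM2r; [exact: mulr_ge0 (ltW k0) n0|lra].
  lra.
have R2 : `|expR x * sin y - y| <= 4 * (k * n) + k * n.
  have -> : expR x * sin y - y = (expR x - 1) * sin y + (sin y - y) by ring.
  apply: le_trans (ler_normD _ _) _; rewrite normrM.
  have : `|expR x - 1| * `|sin y| <= (2 * n) * (2 * n) by apply: ler_pM.
  lra.
have kn8 : k * n <= e / 16 * n by apply: ler_wpM2r.
have kn0 : 0 <= k * n by apply: mulr_ge0 => //; exact: ltW.
apply: le_trans (lerD R1 R2) _; move: kn8 kn0; clear; lra.
Qed.

Lemma is_derive_cexp z : is_derive z 1 (@cexp R) (cexp z).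
Proof.
have /cderiv_epsP H := is_derive_cexp0.
apply/cderiv_epsP => e e0; have ez0 : 0 < expR (Re z) by exact: expR_gt0.
have [d d0 Hd] := H (e / expR (Re z)) ltac:(exact: divr_gt0).
exists d => // w wz; have := Hd (w - z); rewrite !subr0 cexp0 mul1r => /(_ wz) h.
have -> : cexp w - cexp z - cexp z * (w - z) = cexp z * (cexp (w - z) - 1 - (w - z)).
  by rewrite -[in LHS](subrK z w) addrC cexpD; ring.
by rewrite cnormM cnorm_cexp mulrC -ler_pdivlMr// mulrAC.
Qed.

End cexp_theory.

Lemma derivable_cayley_quotient (K : numFieldType) (f : K -> K) (a b c z : K) :
  derivable f z 1 -> f z + b != 0 -> z != 0 ->
  derivable (fun w => c * ((f w - a) / (f w + b) / w)) z 1.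
Proof.
move=> fd fb z0.
have Vb := @derivableV K K (fun w => f w + b) z 1 fb (derivableD fd (derivable_cst b z 1)).
have Vz := @derivableV K K id z 1 z0 (@derivable_id K K z 1).
have fa := derivableB fd (derivable_cst a z 1).
exact: (derivableM (derivable_cst c z 1) (derivableM (derivableM fa Vb) Vz)).
Qed.

Lemma derivable1_near_eq (K : numFieldType) (f g : K -> K) (z : K) :
  (\forall w \near z, f w = g w) -> derivable f z 1 -> derivable g z 1.
Proof. by move=> fg; apply: near_eq_derivable => //; exact: oner_neq0. Qed.

Section center_maximum.
Variables (R : realType) (G : R[i] -> R[i]) (r M : R).
Hypotheses (r0 : 0 < r) (r1 : r < 1).
Hypothesis Gd : forall z, z != 0 -> cnorm z < 1 -> derivable G z 1.
Hypothesis G0 : forall e, 0 < e -> exists2 d, 0 < d &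
  forall z, cnorm z < d -> Re (G 0) - e < Re (G z).
Hypothesis GM : forall z, cnorm z = r -> Re (G z) <= M.

(* In the coordinate log z the integral of Re G over the circle |z| = e^s does
   not depend on s. *)
Lemma center_maximum : Re (G 0) <= M.
Proof.
rewrite leNgt; apply/negP => MG.
(* If [Re (G 0)] exceeded [M], the mean of [Re G] over a small circle would lie above the midpoint
   of the two values, while the mean over the circle of radius [r] is at most [M]. The shift by 1 in
   [s0] makes the small radius strictly smaller than both [r] and [d]. *)
pose e := (Re (G 0) - M) / 2; have e0 : 0 < e by rewrite /e; lra.
have [d d0 Hd] := G0 e0.
pose s1 := ln r; pose s0 := Num.min s1 (ln d) - 1.
have s10 : s1 < 0 by rewrite -ln1 ltr_ln ?posrE.
have s01 : s0 < s1.
  have : Num.min s1 (ln d) <= s1 by rewrite ge_min lexx.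
  by rewrite /s0; lra.
have s0d : expR s0 < d.
  rewrite -[ltRHS](lnK (d0 : d \is Num.pos)) ltr_expR.
  have : Num.min s1 (ln d) <= ln d by rewrite ge_min lexx orbT.
  by rewrite /s0; lra.
have Rexp (s : R) : s < 0 -> expR s < 1 by move=> s_lt0; rewrite expR_lt1.
pose K := G \o @cexp R.
have Kd (x y : R) : x < 0 -> derivable K (x +i* y) 1.
  move=> x0; have cn : cnorm (cexp (x +i* y)) = expR x by rewrite cnorm_cexp.
  have Gdd : is_derive (cexp (x +i* y)) 1 G ('D_1 G (cexp (x +i* y))).
    by apply: DeriveDef => //; apply: Gd; rewrite ?cexp_neq0// cn Rexp.
  by have [] := cderiv_comp Gdd (is_derive_cexp (x +i* y)).
have Kc (x y : R) : x < 0 -> {for (x +i* y), continuous K}.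
  by move=> x0; apply: differentiable_continuous; exact: (derivable1_diffP K (x +i* y)).1 (Kd x y x0).
have ImKc (x y : R) : x < 0 -> {for x, continuous (fun x : R => Im (K (x +i* y)))}.
  move=> x0; apply: (@continuous_comp _ _ _ (fun x : R => x +i* y) (fun z => Im (K z))).
    exact: continuous_horizontal.
  by apply: (@continuous_comp _ _ _ K (fun z => Im z)); [exact: Kc|exact: continuous_Im].
have ReKc (x y : R) : x < 0 -> {for y, continuous (fun y : R => Re (K (x +i* y)))}.
  move=> x0; apply: (@continuous_comp _ _ _ (fun y : R => x +i* y) (fun z => Re (K z))).
    exact: continuous_vertical.
  by apply: (@continuous_comp _ _ _ K (fun z => Re z)); [exact: Kc|exact: continuous_Re].
pose T : R := 2 * pi; have T0 : 0 < T by rewrite mulr_gt0// pi_gt0.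
have /choice[F HF] : forall y : R, exists f : R -> R, forall x : R, s0 <= x <= s1 ->
    is_derive x 1 f (Im (K (x +i* y))).
  (* The interval is enlarged to have primitives at the endpoints; since [s1 < 0], the new right end
     [s1 / 2] is still negative, so [cexp] stays in the unit disc. *)
  move=> y; have [|f Hf] := @continuous_primitive R (fun x => Im (K (x +i* y))) (s0 - 1) (s1 / 2).
    by move=> x /andP[_ xs]; apply: ImKc; lra.
  by exists f => x xs; apply: Hf; lra.
have /choice[P HP] : forall x : R, exists f : R -> R, s0 <= x <= s1 ->
    forall y : R, 0 <= y <= T -> is_derive y 1 f (Re (K (x +i* y))).
  move=> x; have [xs|] := boolP (s0 <= x <= s1); last by exists (fun _ => 0).
  have [|f Hf] := @continuous_primitive R (fun y => Re (K (x +i* y))) (-1) (T + 1).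
    by move=> y _; apply: ReKc; lra.
  by exists f => _ y ys; apply: Hf; lra.
have periodic (x : R) : K (x +i* T) = K (x +i* 0).
  by rewrite /K /= /cexp /= /T mulr_natl cos2pi sin2pi cos0 sin0.
(* [K] takes the same values on the bottom and top sides by periodicity, so one primitive is used
   for both; the horizontal terms of [goursat] then cancel. *)
pose F' (y : R) := if y == T then F 0 else F y.
have HF' (y x : R) : s0 <= x <= s1 -> is_derive x 1 (F' y) (Im (K (x +i* y))).
  by move=> xs; rewrite /F'; case: eqP => [->|_]; [rewrite periodic|]; exact: HF.
have := @goursat R K F' P s0 s1 0 T (ltW s01) (ltW T0) _.
have H : forall x y : R, s0 <= x <= s1 -> 0 <= y <= T ->
  [/\ derivable K (x +i* y) 1, is_derive x 1 (F' y) (Im (K (x +i* y))) &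
      is_derive y 1 (P x) (Re (K (x +i* y)))].
  by move=> x y xs yT; split; [apply: Kd; lra|exact: HF'|exact: HP].
move=> /(_ H); rewrite /F' eqxx (lt_eqF T0) => J.
(* The integral over a circle is its length in the logarithmic coordinate times one value of [Re K]
   on it, so pointwise bounds suffice. *)
have mvt (x : R) : s0 <= x <= s1 -> exists y, P x T - P x 0 = Re (K (x +i* y)) * T.
  move=> xs; have [||y _] := @MVT_segment R (P x) (fun y => Re (K (x +i* y))) 0 T (ltW T0).
  - by move=> y /[!in_itv]/= hy; apply: HP => //; lra.
  - apply: derivable_within_continuous => y /[!in_itv]/= hy.
    by have [] := HP x xs y hy.
  - by rewrite subr0 => ->; exists y.
have [y1 E1] := mvt s1 ltac:(lra); have [y0 E0] := mvt s0 ltac:(lra).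
have b1 : Re (K (s1 +i* y1)) <= M by apply: GM; rewrite cnorm_cexp/= lnK.
have b0 : Re (G 0) - e < Re (K (s0 +i* y0)) by apply: Hd; rewrite cnorm_cexp.
have : Re (K (s1 +i* y1)) * T = Re (K (s0 +i* y0)) * T by lra.
move=> /(mulIf (lt0r_neq0 T0)); rewrite /e in b0; lra.
Qed.

End center_maximum.

(** * Schwarz lemma and Harnack estimate *)

(** The squared moduli of denominator and numerator differ by [4 * Re z * Re c]. *)
Lemma cayley_lt1 (R : rcfType) (z c : R[i]) : 0 < Re z -> 0 < Re c ->
  cnorm ((z - c) / (z + c^*)) < 1.
Proof.
move=> z0 c0; have n0 : 0 < cnorm (z + c^*).
  apply: lt_le_trans (Re_le_cnorm _); rewrite normr_gt0 cReD; case: c c0 => a b /= a0; lra.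
rewrite cnormf ltr_pdivrMr// mul1r -(ltr_pXn2r (n := 2))// ?nnegrE ?cnorm_ge0//.
rewrite !cnorm_sqr cReB cImB cReD cImD -subr_gt0.
case: z c z0 c0 {n0} => [x y] [a b] /= x0 a0.
have := mulr_gt0 x0 a0; lra.
Qed.

Section schwarz.
Variables (R : realType) (H : R[i] -> R[i]).
Hypothesis Hd : forall z, cnorm z < 1 -> derivable H z 1.
Hypothesis Hpos : forall z, cnorm z < 1 -> 0 < Re (H z).

(** The Cayley transform sending [c = H 0] to 0 maps the half-plane into the unit disc; its
    composite with [H], divided by [z], obeys the maximum principle. The derivative of the composite
    at 0 is [L] divided by [2 * Re c]. *)
Lemma schwarz_center (L : R[i]) : is_derive (0 : R[i]) 1 H L -> cnorm L <= 2 * Re (H 0).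
Proof.
move=> /cderiv_epsP HL.
set c := H 0; have c0 : 0 < Re c by apply: Hpos; rewrite cnorm0 ltr01.
pose k := 2 * Re c; have k0 : 0 < k by rewrite mulr_gt0.
have kE : k%:C = c + c^* by rewrite addcJ /k rmorphM rmorph_nat.
have kC0 : k%:C != 0 :> R[i] by rewrite -cnorm_gt0 cnorm_real gtr0_norm.
pose L' := L / k%:C; have LE : L = L' * k%:C by rewrite divfK.
have nL' : cnorm L' = cnorm L / k by rewrite cnormf cnorm_real gtr0_norm.
rewrite -/k -[leRHS]mul1r -ler_pdivrMr// -nL'.
clearbody L'.
have den z : cnorm z < 1 -> Re c <= cnorm (H z + c^*).
  move=> z1; apply: le_trans (Re_le_cnorm _); apply: le_trans (ler_norm _).
  have := Hpos z1; rewrite cReD; case: (c) => a b /=; lra.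
have den0 z : cnorm z < 1 -> H z + c^* != 0.
  by move=> z1; rewrite -cnorm_gt0; exact: lt_le_trans (den z z1).
pose Q z := (H z - c) / (H z + c^*) / z.
(* The singularity at 0 is filled by the derivative [L']. The factor conjugate to [L'] makes
   [Re (G 0)] equal to the square of the modulus of [L'], so a maximum principle for real parts is
   enough. *)
pose G z := L'^* * (if z == 0 then L' else Q z).
set a := cnorm L'; have a0 : 0 <= a by exact: cnorm_ge0.
have GE0 : Re (G 0) = a ^+ 2.
  by rewrite /G eqxx /a cnorm_sqr cReM; case: (L') => x y /=; ring.
(* Letting [r] tend to 1 gives [a <= 1]; if [a > 1], the radius [(1 + a^-1) / 2] is already
   contradictory. *)
suff main r : 0 < r -> r < 1 -> a ^+ 2 <= a / r.
  rewrite leNgt; apply/negP => a1.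
  have ai : 0 < a^-1 by rewrite invr_gt0; lra.
  pose r := (1 + a^-1) / 2; have ai1 : a^-1 < 1 by rewrite invf_lt1//; lra.
  have := main r ltac:(rewrite /r; lra) ltac:(rewrite /r; lra).
  rewrite ler_pdivlMr; last by rewrite /r; lra.
  have aa : a * a^-1 = 1 by rewrite mulfV//; apply: lt0r_neq0; lra.
  have -> : a ^+ 2 * r = (a ^+ 2 + a * (a * a^-1)) / 2 by rewrite /r; move: (a^-1) => b; field.
  rewrite aa mulr1 => h; have : a * (a - 1) <= 0 by lra.
  by rewrite pmulr_rle0; lra.
move=> r0 r1; rewrite -GE0; apply: (@center_maximum R G r) => //.
- move=> z z0 z1.
  have GdE := @derivable_cayley_quotient _ H c c^* L'^* z (Hd z1) (den0 z z1) z0.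
  apply: derivable1_near_eq GdE.
  apply/nbhs_cnormP; exists (cnorm z); first by rewrite cnorm_gt0.
  move=> w wz; rewrite /G; case: eqP => // w0.
  by rewrite w0 sub0r cnormN ltxx in wz.
(* Only differentiability of [H] at 0 is available for the continuity of [G] there. The difference
   [G 0 - G z] has two error terms, from the derivative and from the increment of [H]; [e1] and [d2]
   give each at most half of [e * Re c], and [Re c] bounds the denominator from below. *)
- move=> e e0; set l := cnorm L; have l0 : 0 <= l by exact: cnorm_ge0.
  pose e1 := Num.min 1 (e * Re c / (2 * (a + 1))).
  have eR : 0 < e * Re c by exact: mulr_gt0.
  have e10 : 0 < e1 by rewrite lt_min ltr01/=; apply: divr_gt0; lra.
  have [e11 e1a] : e1 <= 1 /\ e1 * (a + 1) <= e * Re c / 2.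
    split; first by rewrite ge_min lexx.
    rewrite -ler_pdivlMr ?ltr_wpDl//.
    rewrite (_ : e * Re c / 2 / (a + 1) = e * Re c / (2 * (a + 1))) ?ge_min ?lexx ?orbT//.
    by field; apply: lt0r_neq0; lra.
  have [d1 d10 H1] := HL e1 e10.
  pose d2 := e * Re c / (2 * ((a + 1) ^+ 2 * (l + 1))).
  have al0 : 0 < (a + 1) ^+ 2 * (l + 1) by rewrite mulr_gt0 ?exprn_gt0//; lra.
  have d20 : 0 < d2 by apply: divr_gt0 => //; lra.
  exists (Num.min 1 (Num.min d1 d2)); first by rewrite !lt_min ltr01 d10 d20.
  move=> z; rewrite !lt_min => /and3P[z1 zd1 zd2].
  suff : Re (G 0) - Re (G z) < e by lra.
  apply: le_lt_trans (ler_norm _) _; rewrite -cReB.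
  apply: le_lt_trans (Re_le_cnorm _) _; rewrite /G eqxx.
  case: eqP => [_|/eqP z0]; first by rewrite subrr cnorm0.
  set n := cnorm z in z1 zd1 zd2 *; have n0 : 0 < n by rewrite cnorm_gt0.
  have := H1 z; rewrite subr0 -/n -/c => /(_ zd1) {}H1.
  have Hc : cnorm (H z - c) <= (l + 1) * n.
    rewrite -[H z - c](subrK (L * z)); apply: le_trans (cnormD _ _) _.
    rewrite cnormM -/n -/l mulrDl addrC lerD2l mul1r; apply: le_trans H1 _.
    by apply: ler_piMl => //; exact: ltW.
  have -> : L'^* * L' - L'^* * Q z =
      - (L'^* / (z * (H z + c^*)) * ((H z - c - L * z) - L' * z * (H z - c))).
    by rewrite LE kE /Q; field; rewrite z0 den0.
  rewrite cnormN cnormM cnormf cnormJ cnormM -/a -/n.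
  set D := cnorm (H z + c^*); have DR : Re c <= D by exact: den.
  have D0 : 0 < D by exact: lt_le_trans DR.
  have num : cnorm (H z - c - L * z - L' * z * (H z - c)) <= (e1 + a * ((l + 1) * n)) * n.
    apply: le_trans (cnormB _ _) _; rewrite mulrDl lerD// cnormM cnormM -/a -/n.
    by rewrite mulrAC ler_wpM2r ?(ltW n0)// ler_wpM2l.
  rewrite mulrAC ltr_pdivrMr ?mulr_gt0//.
  apply: le_lt_trans (ler_wpM2l a0 num) _.
  rewrite [ltLHS]mulrA [ltRHS]mulrCA [ltRHS]mulrC ltr_pM2r//.
  apply: lt_le_trans (ler_wpM2l (ltW e0) DR).
  have : a * (a * ((l + 1) * n)) < e * Re c / 2.
    apply: (@le_lt_trans _ _ ((a + 1) ^+ 2 * (l + 1) * n)).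
      have -> : a * (a * ((l + 1) * n)) = a ^+ 2 * ((l + 1) * n) by ring.
      rewrite -mulrA ler_wpM2r ?mulr_ge0 ?(ltW n0)//; first by lra.
      by rewrite ler_pXn2r ?nnegrE//; lra.
    rewrite mulrC -ltr_pdivlMr//; apply: lt_le_trans zd2 _.
    by rewrite /d2 invfM mulrA.
  have : e1 * a <= e1 * (a + 1) by rewrite ler_pM2l//; lra.
  rewrite mulrDr; lra.
- move=> z zr; have z0 : z != 0 by rewrite -cnorm_gt0 zr.
  apply: le_trans (ler_norm _) _; apply: le_trans (Re_le_cnorm _) _.
  rewrite /G (negPf z0) cnormM cnormJ -/a; apply: ler_wpM2l => //.
  rewrite /Q cnormf zr ler_pdivrMr// mulVf ?lt0r_neq0//.
  by apply/ltW/cayley_lt1 => //; apply: Hpos; rewrite zr.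
Qed.

End schwarz.

Lemma is_derive_mobius (K : numFieldType) (a w : K) : 1 + a * w != 0 ->
  is_derive w 1 (fun u => (u + a) / (1 + a * u)) ((1 - a ^+ 2) / (1 + a * w) ^+ 2).
Proof.
move=> d0.
have nd : is_derive w 1 (fun u : K => u + a) (1 + 0).
  exact: (is_deriveD (is_derive_id w 1) (is_derive_cst a w 1)).
have ad : is_derive w 1 (fun u : K => a * u) (a *: 1 + w *: 0).
  exact: (is_deriveM (is_derive_cst a w 1) (is_derive_id w 1)).
have dd : is_derive w 1 (fun u : K => 1 + a * u) (0 + (a *: 1 + w *: 0)).
  exact: (is_deriveD (is_derive_cst (1 : K) w 1) ad).
have Vd : is_derive w 1 (fun u : K => (1 + a * u)^-1)
    (- (1 + a * w) ^- 2 *: (0 + (a *: 1 + w *: 0))).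
  case: dd => ddd <-; apply: DeriveDef; first exact: (@derivableV K K (fun u : K => 1 + a * u) w 1 d0 ddd).
  exact: (@deriveV K K (fun u : K => 1 + a * u) w 1 d0 ddd).
have MD := is_deriveM nd Vd.
apply: (is_derive_eq MD).
rewrite -![_ *: _]/(_ * _); field; exact: d0.
Qed.

Section harnack.
Variables (R : realType) (H : R[i] -> R[i]).
Hypothesis Hd : forall z, cnorm z < 1 -> derivable H z 1.
Hypothesis Hpos : forall z, cnorm z < 1 -> 0 < Re (H z).

(** Schwarz-Pick at a real point: the disc automorphism [psi] moves 0 to [x] and has derivative
    [1 - x ^+ 2] at 0, so [schwarz_center] applies to [H \o psi]. *)
Lemma schwarz_real_axis (x : R) (L : R[i]) : -1 < x < 1 -> is_derive x%:C 1 H L ->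
  cnorm L * (1 - x ^+ 2) <= 2 * Re (H x%:C).
Proof.
move=> x1 HL; have x2 : 0 < 1 - x ^+ 2.
  have -> : 1 - x ^+ 2 = (1 - x) * (1 + x) by ring.
  by apply: mulr_gt0; lra.
pose psi (w : R[i]) := (w + x%:C) / (1 + x%:C * w).
have den (w : R[i]) : cnorm w < 1 -> cnorm (w + x%:C) < cnorm (1 + x%:C * w).
  move=> w1; rewrite -(ltr_pXn2r (n := 2))// ?nnegrE ?cnorm_ge0//.
  have : cnorm w ^+ 2 < 1 by rewrite expr_lt1// cnorm_ge0.
  rewrite !cnorm_sqr !cReD !cImD cReM cImM; case: (w) => a b /= ab.
  rewrite !mul0r subr0 !addr0 add0r -subr_gt0.
  have -> : (1 + x * a) ^+ 2 + (x * b) ^+ 2 - ((a + x) ^+ 2 + b ^+ 2)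
     = (1 - x ^+ 2) * (1 - (a ^+ 2 + b ^+ 2)) by ring.
  by apply: mulr_gt0 => //; lra.
have den0 (w : R[i]) : cnorm w < 1 -> 1 + x%:C * w != 0.
  by move=> w1; rewrite -cnorm_gt0; apply: le_lt_trans (den w w1); exact: cnorm_ge0.
have psi1 (w : R[i]) : cnorm w < 1 -> cnorm (psi w) < 1.
  by move=> w1; rewrite cnormf ltr_pdivrMr ?mul1r ?den// cnorm_gt0 den0.
have psid (w : R[i]) : cnorm w < 1 -> is_derive w 1 psi ((1 - x%:C ^+ 2) / (1 + x%:C * w) ^+ 2).
  by move=> w1; apply: is_derive_mobius; exact: den0.
have psi0 : psi 0 = x%:C by rewrite /psi add0r mulr0 addr0 divr1.
have D0 : is_derive (0 : R[i]) 1 (H \o psi) (L * (1 - x ^+ 2)%:C).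
  apply: cderiv_comp; first by rewrite psi0.
  have := psid 0; rewrite cnorm0 mulr0 addr0 expr1n divr1 => /(_ ltr01).
  by rewrite rmorphB rmorph1 rmorphXn.
have := @schwarz_center R (H \o psi) _ _ _ D0.
rewrite /= psi0 cnormM cnorm_real (gtr0_norm x2); apply.
- move=> z z1; have HdE : is_derive (psi z) 1 H ('D_1 H (psi z)).
    by apply: DeriveDef => //; apply: Hd; exact: psi1.
  by have [] := cderiv_comp HdE (psid z z1).
- by move=> z z1; apply: Hpos; exact: psi1.
Qed.

Lemma is_derive_Re_real (f : R[i] -> R[i]) (x : R) (L : R[i]) :
  is_derive x%:C 1 f L -> is_derive x 1 (fun u : R => Re (f u%:C)) (Re L).
Proof.
move=> /cderiv_epsP fL; apply/is_derive_epsP => e e0; have [d d0 Hd'] := fL e e0.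
apply/nbhs_normP; exists d => //= y; rewrite /= distrC => yx.
have := Hd' y%:C; rewrite -rmorphB cnorm_real => /(_ yx); apply: le_trans.
apply: le_trans (Re_le_cnorm _); rewrite !cReB cReM /= mulr0 subr0.
by rewrite [_ *: _]mulrC.
Qed.

Lemma is_derive_Im_real (f : R[i] -> R[i]) (x : R) (L : R[i]) :
  is_derive x%:C 1 f L -> is_derive x 1 (fun u : R => Im (f u%:C)) (Im L).
Proof.
move=> /cderiv_epsP fL; apply/is_derive_epsP => e e0; have [d d0 Hd'] := fL e e0.
apply/nbhs_normP; exists d => //= y; rewrite /= distrC => yx.
have := Hd' y%:C; rewrite -rmorphB cnorm_real => /(_ yx); apply: le_trans.
apply: le_trans (Im_le_cnorm _); rewrite !cImB cImM /= mulr0 add0r.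
by rewrite [_ *: _]mulrC.
Qed.

(* By Schwarz-Pick, |H x|^2 ((1 - x) / (1 + x))^2 is nonincreasing on ]-1, 1[. *)
Lemma harnack_modulus (x : R) : -1 < x -> x <= 0 ->
  cnorm (H 0) * (1 + x) <= cnorm (H x%:C) * (1 - x).
Proof.
move=> x1 x0.
pose u (y : R) : R := Re (H y%:C); pose v (y : R) : R := Im (H y%:C).
pose L (y : R) : R[i] := 'D_1 H y%:C.
pose N (y : R) : R := (u y ^+ 2 + v y ^+ 2) * ((1 - y) * (1 + y)^-1) ^+ 2.
pose dN (y : R) : R := 2 * (u y * Re (L y) + v y * Im (L y)) * ((1 - y) / (1 + y)) ^+ 2
   - (u y ^+ 2 + v y ^+ 2) * (4 * (1 - y) / (1 + y) ^+ 3).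
have LD (y : R) : x <= y <= 0 -> is_derive y%:C 1 H (L y).
  by move=> yx; apply: DeriveDef => //; apply: Hd; rewrite cnorm_real ltr_norml; lra.
have ND (y : R) : x <= y <= 0 -> is_derive y 1 N (dN y).
  move=> yx; have y1 : 1 + y != 0 by apply: lt0r_neq0; lra.
  have ud : is_derive y 1 u (Re (L y)) by apply: is_derive_Re_real; exact: LD.
  have vd : is_derive y 1 v (Im (L y)) by apply: is_derive_Im_real; exact: LD.
  have id : is_derive y 1 (fun y : R => (1 + y)^-1) (- (1 + y) ^- 2 *: (0 + 1)).
    exact: is_deriveV.
  apply: is_derive_eq; rewrite -![_ *: _]/(_ * _) /dN; field; exact: y1.
have [||c] := @MVT_segment R N dN x 0 x0.
- by move=> y /[!in_itv]/= yx; apply: ND; lra.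
- by apply: derivable_within_continuous => y /[!in_itv]/= yx; have [] := ND y yx.
rewrite in_itv/= => xc E.
have dN0 : dN c <= 0.
  have c1 : 0 < 1 - c by lra.
  have c2 : 0 < 1 + c by lra.
  have c0 : 1 + c != 0 by exact: lt0r_neq0.
  have c0' : 1 - c != 0 by exact: lt0r_neq0.
  have SL := schwarz_real_axis (L := L c) _ (LD c xc).
  (* Weakening [Re H] to [|H|] bounds the logarithmic derivative of [H] by the hyperbolic density;
     this is what gives Harnack for the modulus instead of the real part. *)
  have {SL} : cnorm (L c) * (1 - c ^+ 2) <= 2 * cnorm (H c%:C).
    apply: le_trans (SL _) _; first by lra.
    by rewrite ler_pM2l//; apply: le_trans (ler_norm _) (Re_le_cnorm _).
  have -> : 1 - c ^+ 2 = (1 - c) * (1 + c) by ring.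
  move=> SL; set n := cnorm (H c%:C) in SL.
  have n0 : 0 <= n by exact: cnorm_ge0.
  have nE : u c ^+ 2 + v c ^+ 2 = n ^+ 2 by rewrite /n cnorm_sqr.
  have dot : u c * Re (L c) + v c * Im (L c) <= n * cnorm (L c).
    rewrite -[cnorm (L c)]cnormJ -cnormM; apply: le_trans (Re_le_cnorm _).
    apply: le_trans (ler_norm _); rewrite cReM; case: (L c) => a b /=.
    by rewrite /u /v; case: (H c%:C) => p q /=; lra.
  rewrite /dN nE.
  have -> : 2 * (u c * Re (L c) + v c * Im (L c)) * ((1 - c) / (1 + c)) ^+ 2
    - n ^+ 2 * (4 * (1 - c) / (1 + c) ^+ 3) =
    (2 * (1 - c) / (1 + c) ^+ 3) *
    ((u c * Re (L c) + v c * Im (L c)) * ((1 - c) * (1 + c)) - 2 * n ^+ 2) by field.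
  apply: mulr_ge0_le0; first by rewrite divr_ge0 ?exprn_ge0//; lra.
  have cc : 0 <= (1 - c) * (1 + c) by rewrite mulr_ge0 ?ltW.
  have := ler_wpM2r cc dot; have := ler_wpM2l n0 SL; lra.
have : N 0 <= N x by rewrite -subr_le0 E; apply: mulr_le0_ge0 => //; lra.
have NE (y : R) : N y = (cnorm (H y%:C) * ((1 - y) / (1 + y))) ^+ 2.
  by rewrite exprMn cnorm_sqr.
have q0 : 0 <= (1 - x) / (1 + x) by rewrite divr_ge0//; lra.
have a0 := mulr_ge0 (cnorm_ge0 (H x%:C)) q0.
rewrite !NE subr0 addr0 divr1 mulr1 ler_pXn2r ?nnegrE ?cnorm_ge0//.
by rewrite mulrA ler_pdivlMr//; lra.
Qed.

End harnack.

(** After rescaling to the unit disc the point [s] becomes [s / t - 1], which lies in []-1, 0]];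
    [harnack_modulus] gives the factor [2 - s / t] on the right, bounded by 2. *)
Lemma halfplane_disc_growth (R : realType) (h : R[i] -> R[i]) (s t : R) :
  (forall z, cnorm (z - t%:C) < t -> derivable h z 1) ->
  (forall z, cnorm (z - t%:C) < t -> 0 < Re (h z)) ->
  0 < s -> s <= t -> cnorm (h t%:C) <= 2 * t / s * cnorm (h s%:C).
Proof.
move=> hd hpos s0 st; have t0 : 0 < t by lra.
pose A (z : R[i]) := t%:C + t%:C * z.
have AC (z : R[i]) : cnorm z < 1 -> cnorm (A z - t%:C) < t.
  by move=> z1; rewrite /A addrAC subrr add0r cnormM cnorm_real gtr0_norm// gtr_pMr.
have Ad (z : R[i]) : is_derive z 1 A t%:C.
  apply/cderiv_epsP => e e0; exists 1 => // w _.
  rewrite (_ : A w - A z - t%:C * (w - z) = 0) ?cnorm0 ?mulr_ge0 ?(ltW e0) ?cnorm_ge0//.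
  by rewrite /A; ring.
have := @harnack_modulus R (h \o A) _ _ (s / t - 1).
have st0 : 0 < s / t by exact: divr_gt0.
have st1 : s / t <= 1 by rewrite ler_pdivrMr// mul1r.
have -> : (h \o A) 0 = h t%:C by rewrite /= /A mulr0 addr0.
have -> : (h \o A) (s / t - 1)%:C = h s%:C.
  rewrite /= /A -rmorphM -rmorphD mulrBr mulr1 addrC subrK mulrC divfK//; exact: lt0r_neq0.
move=> K; have {K} : cnorm (h t%:C) * (s / t) <= cnorm (h s%:C) * 2.
  apply: (@le_trans _ _ (cnorm (h s%:C) * (1 - (s / t - 1)))).
    rewrite [X in _ * X <= _](_ : s / t = 1 + (s / t - 1)); last by ring.
    apply: K; [|by move=> z z1; apply: hpos; exact: AC|lra|lra].
    move=> z z1; have hE : is_derive (A z) 1 h ('D_1 h (A z)).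
      by apply: DeriveDef => //; apply: hd; exact: AC.
    by have [] := cderiv_comp hE (Ad z).
  apply: ler_wpM2l; [exact: cnorm_ge0|lra].
rewrite mulrA ler_pdivrMr// -ler_pdivlMr// => K; apply: le_trans K _.
by rewrite le_eqVlt; apply/orP; left; apply/eqP; ring.
Qed.

(** * Powers on the right half-plane *)

(** Expand [cos (th + al * th)]. Near [pi / 2] the product of sines is bounded below; away from it
    the second copy of [cos th] pays for [c]. Since [al <= 1], the angle [al * th] stays where sine
    is monotone. *)
Lemma cos_1D_mul_le (R : realType) (al : R) : 0 < al -> al <= 1 ->
  exists2 c : R, 0 < c <= 1 & forall th, - (pi / 2) < th < pi / 2 ->
    cos ((1 + al) * th) <= 2 * cos th - c.
Proof.
move=> al0 al1; have pi0 : 0 < pi :> R by exact: pi_gt0.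
have alpi : 0 < al * (pi / 4) <= pi / 4.
  by rewrite mulr_gt0 ?divr_gt0//= ler_piMl// divr_ge0// ltW.
have s1 : 0 < sin (pi / 4) :> R by apply: sin_gt0_pihalf; lra.
have s2 : 0 < sin (al * (pi / 4)) by apply: sin_gt0_pihalf; lra.
have s1l := @sin_le1 R (pi / 4); have s2l := sin_le1 (al * (pi / 4)).
pose c : R := sin (pi / 4) * sin (al * (pi / 4)).
have c0 : 0 < c by exact: mulr_gt0.
have c1 : c <= sin (pi / 4) by apply: ler_piMr => //; exact: ltW.
have lesin (x y : R) : 0 <= x -> x <= y -> y <= pi / 2 -> sin x <= sin y.
  move=> x0 xy y2; rewrite le_eqVlt; case: (ltgtP x y) xy => // [xy _|-> _]; last by rewrite eqxx.
  by rewrite ltr_sin ?xy ?orbT// in_itv/=; lra.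
have cospos (x : R) : 0 <= x -> x < pi / 2 -> cos ((1 + al) * x) <= 2 * cos x - c.
  move=> x0 x2; have alx : 0 <= al * x <= x by rewrite mulr_ge0 ?(ltW al0)//= ler_piMl.
  have cx : 0 <= cos x by apply/ltW/cos_gt0_pihalf; lra.
  have cc : cos x * cos (al * x) <= cos x by apply: ler_piMr => //; exact: cos_le1.
  (* Beyond [pi / 4] the product of sines is at least [c]; below it, [cos x] is at least
     [sin (pi / 4)], hence at least [c]. *)
  rewrite mulrDl mul1r cosD; have [x4|x4] := leP (pi / 4) x.
    have h1 : sin (pi / 4) <= sin x by apply: lesin; lra.
    have al4 : al * (pi / 4) <= al * x by rewrite ler_pM2l.
    have h2 : sin (al * (pi / 4)) <= sin (al * x) by apply: lesin; lra.
    have : c <= sin x * sin (al * x) by apply: ler_pM => //; exact: ltW.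
    lra.
  have h1 : 0 <= sin x * sin (al * x).
    by apply: mulr_ge0; apply: sin_ge0_pi; lra.
  have h2 : sin (pi / 4) <= cos x.
    by rewrite -[cos x]cosN -sinDpihalf; apply: lesin; lra.
  lra.
exists c; first by rewrite c0 (le_trans c1).
move=> th thpi; have [t0|t0] := leP 0 th; first by apply: cospos; lra.
by rewrite -cosN -mulrN -[cos th]cosN; apply: cospos; lra.
Qed.

(** The principal logarithm; the formula with [atan] gives the argument only on the open right
    half-plane, where alone it is used. *)
Definition clog (R : realType) (w : R[i]) : R[i] := ln (cnorm w) +i* atan (Im w / Re w).

Section clog_theory.
Variable R : realType.
Implicit Types w z : R[i].

Lemma clogK w : 0 < Re w -> cexp (clog w) = w.
Proof.
move=> w0; have n0 : 0 < cnorm w by apply: lt_le_trans (Re_le_cnorm w); rewrite normr_gt0 lt0r_neq0.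
pose t := Im w / Re w.
have nE : cnorm w = Re w * Num.sqrt (1 + t ^+ 2).
  rewrite -[X in X * _](ger0_norm (ltW w0)) -sqrtr_sqr -sqrtrM ?sqr_ge0//.
  by rewrite cnorm_def /t; congr Num.sqrt; field; exact: lt0r_neq0.
have s0 : Num.sqrt (1 + t ^+ 2) != 0.
  by rewrite sqrtr_eq0 -ltNge ltr_pwDl ?sqr_ge0.
have cosE : cnorm w * cos (atan t) = Re w by rewrite cos_atan nE mulfK.
rewrite /cexp /= lnK ?posrE// -/t cosE.
have sinE : sin (atan t) = cos (atan t) * t.
  rewrite -{3}[t]atanK /tan mulrCA mulfV ?mulr1// cos_atan invr_eq0//.
rewrite sinE mulrA cosE /t mulrCA mulfV ?mulr1 ?lt0r_neq0//.
exact: complex_eq.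
Qed.

Lemma continuous_at_eps (f : R[i] -> R) z : {for z, continuous f} ->
  forall e, 0 < e -> exists2 d, 0 < d & forall w, cnorm (w - z) < d -> `|f w - f z| < e.
Proof.
move=> fc e e0.
have /nbhs_cnormP[d d0 H] := (@cvgrPdist_lt _ _ _ (nbhs z) (nbhs_filter z) f (f z)).1 fc e e0.
by exists d => // w /H; rewrite distrC.
Qed.

Lemma continuous_cnorm : continuous (fun z : R[i] => cnorm z).
Proof.
move=> z; apply/(@cvgrPdist_lt _ _ _ (nbhs z) (nbhs_filter z)) => e e0.
apply/nbhs_cnormP; exists e => // w wz; apply: le_lt_trans wz.
by rewrite distrC ler_norml cnormBr andbT lerNl opprB cdistrC cnormBr.
Qed.

Lemma clog_eps z : 0 < Re z -> forall e, 0 < e -> exists2 d, 0 < d &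
  forall w, cnorm (w - z) < d -> 0 < Re w /\ cnorm (clog w - clog z) < e.
Proof.
move=> z0 e e0; have n0 : 0 < cnorm z.
  by apply: lt_le_trans (Re_le_cnorm z); rewrite normr_gt0 lt0r_neq0.
have lnc : {for z, continuous (fun w : R[i] => ln (cnorm w))}.
  apply: (@continuous_comp _ _ _ (fun w : R[i] => cnorm w) (@ln R)).
    exact: continuous_cnorm.
  exact: continuous_ln.
have atc : {for z, continuous (fun w : R[i] => atan (Im w / Re w))}.
  apply: (@continuous_comp _ _ _ (fun w : R[i] => Im w / Re w) (@atan R)); last exact: continuous_atan.
  apply: (@continuousM R _ (fun w : R[i] => Im w) (fun w : R[i] => (Re w)^-1)).
    exact: continuous_Im.
  by apply: (@continuousV R _ (fun w : R[i] => Re w)); [exact: lt0r_neq0|exact: continuous_Re].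
have [d1 d10 H1] := continuous_at_eps lnc (divr_gt0 e0 (ltr0Sn _ 1)).
have [d2 d20 H2] := continuous_at_eps atc (divr_gt0 e0 (ltr0Sn _ 1)).
exists (Num.min (Re z) (Num.min d1 d2)); first by rewrite !lt_min z0 d10 d20.
move=> w; rewrite !lt_min => /and3P[w0 /H1 h1 /H2 h2]; split.
  have := le_lt_trans (Re_le_cnorm _) w0; rewrite cReB ltr_norml; lra.
apply: le_lt_trans (cnorm_le_ReIm _) _; rewrite cReB cImB /=; lra.
Qed.

(** The first-order expansion of [cexp] at [clog z] is read backwards; continuity of [clog] makes
    the increment [D] small enough for that expansion. *)
Lemma is_derive_clog z : 0 < Re z -> is_derive z 1 (@clog R) z^-1.
Proof.
move=> z0; have n0 : 0 < cnorm z.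
  by apply: lt_le_trans (Re_le_cnorm z); rewrite normr_gt0 lt0r_neq0.
have zn0 : z != 0 by rewrite -cnorm_gt0.
have /cderiv_epsP HE := is_derive_cexp (clog z); rewrite clogK// in HE.
apply/cderiv_epsP => e e0; set n := cnorm z in n0.
(* The bound [n / 2] allows the error to be absorbed, giving [n * cnorm D <= 2 * cnorm (w - z)]; the
   other bound then yields the tolerance [e]. *)
pose k := Num.min (n / 2) (e * n ^+ 2 / 2).
have k0 : 0 < k by rewrite lt_min !divr_gt0// mulr_gt0// exprn_gt0.
have [k1 k2] : k <= n / 2 /\ k <= e * n ^+ 2 / 2 by rewrite !ge_min !lexx orbT.
have [d d0 Hd] := HE k k0; have [d' d'0 Hd'] := clog_eps z0 d0.
exists d' => // w /Hd'[w0 /Hd]; rewrite clogK//.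
set D := clog w - clog z => h.
have D1 : n * cnorm D <= 2 * cnorm (w - z).
  have : n * cnorm D <= cnorm (w - z) + k * cnorm D.
    rewrite /n -cnormM -[z * D](subKr (w - z)).
    by apply: le_trans (cnormB _ _) _; rewrite lerD2l.
  have := ler_wpM2r (cnorm_ge0 D) k1; lra.
have -> : D - z^-1 * (w - z) = - (z^-1 * (w - z - z * D)).
  by field.
rewrite cnormN cnormM cnormV -/n mulrC ler_pdivrMr//; apply: le_trans h _.
apply: le_trans (ler_wpM2r (cnorm_ge0 D) k2) _.
have -> : e * n ^+ 2 / 2 * cnorm D = e * n / 2 * (n * cnorm D) by ring.
have en : 0 <= e * n / 2 by rewrite divr_ge0// mulr_ge0// ltW.
apply: le_trans (ler_wpM2l en D1) _; lra.
Qed.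

End clog_theory.

Definition cpow (R : realType) (a : R) (w : R[i]) : R[i] := cexp (a%:C * clog w).

Section cpow_theory.
Variable R : realType.
Implicit Types (a : R) (w : R[i]).

Lemma Re_gt0_cnorm w : 0 < Re w -> 0 < cnorm w.
Proof. by move=> w0; apply: lt_le_trans (Re_le_cnorm w); rewrite normr_gt0 lt0r_neq0. Qed.

Lemma derivable_cpow a w : 0 < Re w -> derivable (cpow a) w 1.
Proof.
move=> w0; have md : is_derive (clog w) 1 (fun z : R[i] => a%:C * z) a%:C.
  apply/cderiv_epsP => e e0; exists 1 => // u _.
  by rewrite -mulrBr subrr cnorm0 mulr_ge0 ?cnorm_ge0// ltW.
have := @cderiv_comp R (@cexp R) ((fun z : R[i] => a%:C * z) \o @clog R) w _ _
  (is_derive_cexp (a%:C * clog w)) (cderiv_comp md (is_derive_clog w0)).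
by case.
Qed.

Lemma cnorm_cpow a w : 0 < Re w -> cnorm (cpow a w) = cnorm w `^ a.
Proof.
move=> w0; have n0 := Re_gt0_cnorm w0.
by rewrite cnorm_cexp cReM /= mul0r subr0 /powR gt_eqF.
Qed.

Lemma Re_cpow a w : 0 < Re w ->
  Re (cpow a w) = cnorm w `^ a * cos (a * Im (clog w)).
Proof.
move=> w0; have n0 := Re_gt0_cnorm w0.
by rewrite /cpow /cexp cReM cImM /= !mul0r subr0 addr0 /powR gt_eqF.
Qed.

Lemma cpow_real a (s : R) : 0 < s -> cpow a s%:C = (s `^ a)%:C.
Proof.
move=> s0; rewrite /cpow /cexp cReM cImM /= !mul0r subr0 addr0 cnorm_real gtr0_norm//.
by rewrite atan0 mulr0 cos0 sin0 mulr1 mulr0 /powR gt_eqF.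
Qed.

Lemma cos_arg w : 0 < Re w -> cnorm w * cos (Im (clog w)) = Re w.
Proof.
move=> w0; have := clogK w0; rewrite /cexp => /(congr1 Re) /=.
by rewrite lnK// posrE; exact: Re_gt0_cnorm.
Qed.

(* [w - K w^(1 + al)] bends the imaginary axis to the right by a multiple of
   [|w|^(1 + al)], because [Re w^(1 + al) < 0] on that axis. *)
Lemma curved_halfplane (al M : R) : 0 < al -> al <= 1 -> 0 <= M ->
  exists (phi : R[i] -> R[i]) (t0 K : R), [/\ 0 < t0, M <= K,
    forall w, 0 < Re w -> cnorm w <= t0 -> [/\ derivable phi w 1,
      M * cnorm w `^ (1 + al) < Re (phi w) & cnorm (phi w) <= 2 * cnorm w] &
    forall s, 0 < s -> phi s%:C = (s - K * s `^ (1 + al))%:C].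
Proof.
move=> al0 al1 M0; have [c /andP[c0 c1] Hc] := cos_1D_mul_le al0 al1.
(* The constant [c] of [cos_1D_mul_le] yields a gain [K * c = M + 1] times the power of order
   [1 + al]: [M] is required, and the extra 1 makes the inequality strict. As [c <= 1], also
   [M <= K]. *)
pose K := (M + 1) / c; have K0 : 0 < K by rewrite divr_gt0// ltr_wpDl.
have KM : M + 1 <= K by rewrite ler_pdivlMr// ler_piMr//; lra.
(* Chosen so that [K] times the power [al] of [t0] is 1/2: the loss [2 * cos th] in the bend is then
   covered by [Re w]. *)
pose t0 := (2 * K)^-1 `^ al^-1.
have K20 : 0 < (2 * K)^-1 by rewrite invr_gt0 mulr_gt0.
have t00 : 0 < t0 by rewrite powR_gt0.
have powle w : cnorm w <= t0 -> K * cnorm w `^ al <= 1 / 2.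
  move=> wt; have : cnorm w `^ al <= t0 `^ al.
    apply: ge0_ler_powR => //; rewrite ?nnegrE ?cnorm_ge0//; exact: ltW.
  rewrite -powRrM mulVf ?lt0r_neq0// powRr1 ?(ltW K20)// => h.
  apply: le_trans (ler_wpM2l (ltW K0) h) _.
  by rewrite invfM mulrCA mulfV ?lt0r_neq0// mulr1 mul1r.
exists (fun w => w - K%:C * cpow (1 + al) w), t0, K; split => //.
- lra.
- move=> w w0 wt; have n0 := Re_gt0_cnorm w0; have {powle}Kw := powle w wt.
  have powS : cnorm w `^ (1 + al) = cnorm w * cnorm w `^ al.
    by rewrite powRD ?powRr1 ?(ltW n0)// lt0r_neq0// implybT.
  set p := cnorm w `^ al in Kw powS; have p0 : 0 < p by rewrite powR_gt0.
  split.
  + have := @derivable_cpow (1 + al) w w0; move=> pd.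
    have pD : is_derive w 1 (cpow (1 + al)) ('D_1 (cpow (1 + al)) w) by exact: DeriveDef.
    have Ld : is_derive (cpow (1 + al) w) 1 (fun z : R[i] => K%:C * z) K%:C.
      apply/cderiv_epsP => e e0; exists 1 => // u _.
      by rewrite -mulrBr subrr cnorm0 mulr_ge0 ?cnorm_ge0// ltW.
    have [KD _] := cderiv_comp Ld pD.
    exact: (@derivableB _ _ _ (fun z : R[i] => z) _ w 1 (@derivable_id _ _ w 1) KD).
  + rewrite cReB cReM [Re K%:C]/= [Im K%:C]/= mul0r subr0 Re_cpow// powS -(cos_arg w0).
    set th := Im (clog w).
    have := Hc th; rewrite atan_gtNpi2 atan_ltpi2 => /(_ isT).
    have cth : 0 < cos th.
      by have := w0; rewrite -(cos_arg w0) pmulr_rgt0.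
    set n := cnorm w in n0 *; set C1 := cos _; set C := cos th in cth * => hC.
    have np0 : 0 < n * p by exact: mulr_gt0.
    have Kc : K * c = M + 1 by rewrite /K divfK// lt0r_neq0.
    have h1 : K * (n * p * C1) <= K * (n * p * (2 * C - c)).
      by rewrite ler_pM2l// ler_pM2l.
    have h2 : K * (n * p * (2 * C - c)) = 2 * (K * p) * (n * C) - (M + 1) * (n * p).
      by rewrite -Kc; ring.
    have h3 : 2 * (K * p) * (n * C) <= n * C.
      apply: ler_piMl; last by lra.
      by rewrite mulr_ge0 ?ltW.
    lra.
  + apply: le_trans (cnormB _ _) _.
    rewrite cnormM cnorm_real gtr0_norm// cnorm_cpow// powS mulrCA.
    have : cnorm w * (K * p) <= cnorm w * (1 / 2) by rewrite ler_pM2l.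
    lra.
- by move=> s s0; rewrite cpow_real// -rmorphM -rmorphB.
Qed.

End cpow_theory.

(** * Charts of the boundary *)

Section row_norms.
Variables (K : numDomainType) (d : nat).
Implicit Types v : 'rV[K]_d.

Lemma row_norm_entry v j : `|v 0 j| <= `|v|.
Proof.
by rewrite [leRHS]/Num.norm /= mx_normE -[leLHS]nngE num_le (le_bigmax _ _ (0, j)).
Qed.

Lemma row_norm_le v (c : K) : 0 <= c -> (forall j, `|v 0 j| <= c) -> `|v| <= c.
Proof.
move=> c0 H; rewrite [leLHS]/Num.norm /=.
have [->//|/mx_norm_neq0[[i j] ->] /=] := eqVneq (mx_norm v) 0.
by rewrite (ord1 i).
Qed.

End row_norms.

Section crow_norms.
Variables (R : rcfType) (d : nat).
Implicit Types v : 'rV[R[i]]_d.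

Lemma cnorm_entry v j : cnorm (v 0 j) <= cnorm v.
Proof. by rewrite -lecR -!cnormE row_norm_entry. Qed.

End crow_norms.

(** Bilinear, without conjugation: [cdot a] is complex linear, has the form used in
    [complex_hyperplane], and stays holomorphic after composition with a holomorphic map. *)
Definition cdot (R : rcfType) (d : nat) (a v : 'rV[R[i]]_d) : R[i] :=
  \sum_(j < d) a 0 j * v 0 j.

Section cdot_theory.
Variables (R : rcfType) (d : nat).
Implicit Types a b v w : 'rV[R[i]]_d.

Lemma cdotDr a v w : cdot a (v + w) = cdot a v + cdot a w.
Proof. by rewrite /cdot -big_split; apply: eq_bigr => j _; rewrite mxE mulrDr. Qed.

Lemma cdotZr a (c : R[i]) v : cdot a (c *: v) = c * cdot a v.
Proof. by rewrite /cdot mulr_sumr; apply: eq_bigr => j _; rewrite mxE mulrCA. Qed.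

Lemma cdotNr a v : cdot a (- v) = - cdot a v.
Proof. by rewrite -scaleN1r cdotZr mulN1r. Qed.

Lemma cdotBr a v w : cdot a (v - w) = cdot a v - cdot a w.
Proof. by rewrite cdotDr cdotNr. Qed.

Lemma cdotBl a b v : cdot (a - b) v = cdot a v - cdot b v.
Proof. by rewrite /cdot -sumrB; apply: eq_bigr => j _; rewrite !mxE mulrBl. Qed.

Lemma Re_cdot a v : Re (cdot a v) = \sum_(j < d) Re (a 0 j * v 0 j).
Proof.
by rewrite /cdot; apply: (big_morph (fun z : R[i] => Re z)) => // z w; rewrite cReD.
Qed.

Lemma cnorm_cdot a v : cnorm (cdot a v) <= d%:R * cnorm a * cnorm v.
Proof.
rewrite /cdot; apply: (@le_trans _ _ (\sum_(j < d) cnorm a * cnorm v)); last first.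
  by rewrite sumr_const card_ord -mulrA mulr_natl.
elim/big_ind2 : _ => [|x p y q xp yq|j _]; first by rewrite cnorm0.
  exact: le_trans (cnormD _ _) (lerD xp yq).
by rewrite cnormM ler_pM ?cnorm_ge0 ?cnorm_entry.
Qed.

End cdot_theory.

Section real_coordinates.
Variables (R : realType) (d : nat).

Definition rvec (z : 'rV[R[i]]_d) : 'rV[R]_d * 'rV[R]_d :=
  (\row_j Re (z 0 j), \row_j Im (z 0 j)).

Lemma rvecK z : cvec (rvec z) = z.
Proof. by apply/rowP => j; rewrite !mxE; exact: complex_eq. Qed.

Lemma cvecK p : rvec (@cvec R d p) = p.
Proof. by case: p => p q; congr pair; apply/rowP => j; rewrite !mxE. Qed.

Lemma cvecD p q : @cvec R d (p + q) = cvec p + cvec q.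
Proof. by apply/rowP => j; rewrite !mxE. Qed.

Lemma cvecB p q : @cvec R d (p - q) = cvec p - cvec q.
Proof. by apply/rowP => j; rewrite !mxE. Qed.

Lemma cvecZ (t : R) p : @cvec R d (t *: p) = t%:C *: cvec p.
Proof. by apply/rowP => j; rewrite !mxE; apply: complex_eq; rewrite ?cReM ?cImM /=; ring. Qed.

Lemma norm_rvec z : `|rvec z| <= cnorm z.
Proof.
rewrite prod_normE /= ge_max; apply/andP.
split; apply: row_norm_le => [|j]; rewrite ?cnorm_ge0 ?mxE//.
  exact: le_trans (Re_le_cnorm _) (cnorm_entry _ _).
exact: le_trans (Im_le_cnorm _) (cnorm_entry _ _).
Qed.

(** Every real linear functional is the real part of a complex linear one; the coefficients are
    [L(e_j) - i L(i e_j)]. *)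
Lemma cdot_linear (L : {linear ('rV[R]_d * 'rV[R]_d)%type -> R}) v :
  Re (cdot (\row_j (L (delta_mx 0 j, 0) -i* L (0, delta_mx 0 j))) v) = L (rvec v).
Proof.
have -> : rvec v = \sum_j (Re (v 0 j) *: (delta_mx 0 j, 0) + Im (v 0 j) *: (0, delta_mx 0 j)).
  apply: injective_projections.
    rewrite (@big_morph _ _ (fun p : 'rV[R]_d * 'rV[R]_d => p.1) 0 +%R 0 +%R (fun _ _ => erefl) erefl) /=.
    by rewrite [LHS]row_sum_delta; apply: eq_bigr => j _; rewrite mxE scaler0 addr0.
  rewrite (@big_morph _ _ (fun p : 'rV[R]_d * 'rV[R]_d => p.2) 0 +%R 0 +%R (fun _ _ => erefl) erefl) /=.
  by rewrite [LHS]row_sum_delta; apply: eq_bigr => j _; rewrite mxE scaler0 add0r.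
rewrite Re_cdot [RHS]linear_sum; apply: eq_bigr => j _.
rewrite mxE linearD !linearZ cReM /= -![_ *: _]/(_ * _); ring.
Qed.

End real_coordinates.

(** The scalar field is left general: real lines serve for the Taylor estimate in charts, complex
    lines for holomorphic functions. *)
Lemma is_derive_line (R : numFieldType) (V W : normedModType R) (f : V -> W) (p v : V) (t : R) :
  differentiable f (p + t *: v) ->
  is_derive t 1 (fun s => f (p + s *: v)) ('d f (p + t *: v) v).
Proof.
move=> fd; have fD := @diff_derivable _ _ _ f _ v fd.
have E : (fun h : R => h^-1 *: (((fun s => f (p + s *: v)) \o shift t) (h *: 1) - f (p + t *: v))) =
         (fun h : R => h^-1 *: ((f \o shift (p + t *: v)) (h *: v) - f (p + t *: v))).
  apply/funext => h /=; rewrite [h *: 1]mulr1 /shift /= scalerDl; congr (_ *: (f _ - _)).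
  by rewrite addrCA.
apply: DeriveDef; first by rewrite /derivable E.
by rewrite -(deriveE _ fd) /derive E.
Qed.

(* [A z] is the complex gradient of [r] at [z]: the real differential of [r]
   at [z] is [v |-> Re (cdot (A z) v)]. *)
Record defining_chart (R : realType) (d : nat) (al : R) (Om : set 'rV[R[i]]_d)
    (x : 'rV[R[i]]_d) (rho : R) (r : 'rV[R[i]]_d -> R)
    (A : 'rV[R[i]]_d -> 'rV[R[i]]_d) (M : R) : Prop := DefiningChart {
  chart_rho_gt0 : 0 < rho;
  chart_M_ge0 : 0 <= M;
  chart_taylor : forall z w, cnorm (z - x) < rho -> cnorm (w - x) < rho ->
    `|r w - r z - Re (cdot (A z) (w - z))| <= M * cnorm (w - z) `^ (1 + al);
  chart_holder : forall z w v, cnorm (z - x) < rho -> cnorm (w - x) < rho ->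
    cnorm (cdot (A z) v - cdot (A w) v) <= M * cnorm (z - w) `^ al * cnorm v;
  chart_inside : forall z, cnorm (z - x) < rho -> (Om z <-> r z < 0);
  chart_boundary : forall z, cnorm (z - x) < rho -> (boundary Om z <-> r z = 0);
  chart_gradient : forall z, cnorm (z - x) < rho -> exists v, cdot (A z) v != 0 }.

(** The Taylor estimate is the mean value theorem on a segment, which remains in the ball, combined
    with the Holder bound on the differential. *)
Lemma C1holder_chart (R : realType) (d : nat) (al : R) (Om : set 'rV[R[i]]_d) (x : 'rV[R[i]]_d) :
  0 < al -> C1holder_boundary al Om -> boundary Om x ->
  exists rho r A M, defining_chart al Om x rho r A M.
Proof.
move=> al0 reg bx; have [U [r [[Uo Ux] [rd [M HM]] Uin Ubd Ugr]]] := reg x bx.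
have /nbhs_cnormP[rho rho0 Urho] : nbhs x U by exact: open_nbhs_nbhs.
have [A AE] : exists A : 'rV[R[i]]_d -> 'rV[R[i]]_d,
    forall z v, Re (cdot (A z) v) = 'd (r \o @cvec R d) (rvec z) (rvec v).
  by eexists => z v; exact: cdot_linear.
have HD z w v : cnorm (z - x) < rho -> cnorm (w - x) < rho ->
    `|Re (cdot (A z) v) - Re (cdot (A w) v)| <= `|M| * cnorm (z - w) `^ al * cnorm v.
  move=> zx wx.
  have Uz : U (cvec (rvec z)) by rewrite rvecK; exact: Urho.
  have Uw : U (cvec (rvec w)) by rewrite rvecK; exact: Urho.
  rewrite (AE z v) (AE w v).
  apply: le_trans (HM (rvec z) (rvec w) (rvec v) Uz Uw) _.
  have rB : rvec z - rvec w = rvec (z - w).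
    by rewrite -[LHS]cvecK cvecB !rvecK.
  have M1 : M * `|rvec z - rvec w| `^ al * `|rvec v| <= `|M| * `|rvec z - rvec w| `^ al * `|rvec v|.
    by do 2! (apply: ler_wpM2r; first by rewrite ?normr_ge0 ?powR_ge0); exact: ler_norm.
  apply: le_trans M1 _; apply: ler_pM => //.
  - apply: ler_wpM2l => //; apply: ge0_ler_powR; rewrite ?nnegrE ?cnorm_ge0 ?normr_ge0 ?(ltW al0)//.
    by rewrite rB norm_rvec.
  - exact: norm_rvec.
have powS (c : R) : 0 <= c -> c `^ (1 + al) = c * c `^ al.
  by move=> c0; rewrite powRD ?powRr1//; apply/implyP => /eqP; lra.
(* The hypothesis bounds real parts only; applying it to [v] and to [-i v] bounds both parts of the
   complex functional, whence the factor 2. The absolute value is there because the sign of [M] is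
   unknown. *)
exists rho, r, A, (2 * `|M|); split; first exact: rho0.
- by rewrite mulr_ge0.
- move=> z w zx wx; set v := w - z.
  have seg (t : R) : 0 <= t <= 1 -> cnorm (z + t%:C *: v - x) < rho.
    move=> /andP[t0 t1].
    have -> : z + t%:C *: v - x = (1 - t)%:C *: (z - x) + t%:C *: (w - x).
      by rewrite /v rmorphB/= scalerBl scale1r !scalerBr; apply/rowP => j; rewrite !mxE; ring.
    apply: le_lt_trans (cnormD _ _) _; rewrite !cnormZ !cnorm_real !ger0_norm; [|lra..].
    have [->|t01] := eqVneq t 0; first by rewrite subr0 mul1r mul0r addr0.
    have tgt0 : 0 < t by rewrite lt_def t01.
    have : t * cnorm (w - x) < t * rho by rewrite ltr_pM2l.
    have : (1 - t) * cnorm (z - x) <= (1 - t) * rho by apply: ler_wpM2l; [lra|exact: ltW].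
    lra.
  pose g (t : R) := (r \o @cvec R d) (rvec z + t *: rvec v).
  have gE (t : R) : rvec z + t *: rvec v = rvec (z + t%:C *: v).
    by rewrite -[LHS]cvecK cvecD cvecZ !rvecK.
  pose dg (t : R) := 'd (r \o @cvec R d) (rvec (z + t%:C *: v)) (rvec v).
  have gd (t : R) : 0 <= t <= 1 -> is_derive t 1 g (dg t).
    move=> t01; rewrite /dg -gE; apply: is_derive_line; apply: rd.
    by rewrite gE rvecK; apply: Urho; exact: seg.
  have [||t] := @MVT_segment R g dg 0 1 ler01.
  - by move=> t /[!in_itv]/= t01; apply: gd; lra.
  - by apply: derivable_within_continuous => t /[!in_itv]/= t01; have [] := gd t t01.
  rewrite in_itv/= => t01; rewrite subr0 mulr1 /g !gE scale1r scale0r addr0 /= !rvecK.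
  have zv : z + v = w by rewrite /v addrC subrK.
  rewrite zv => ->; rewrite /dg -AE.
  apply: le_trans (HD _ _ _ (seg _ t01) zx) _.
  have tz : z + t%:C *: v - z = t%:C *: v by rewrite addrAC subrr add0r.
  rewrite tz (powS _ (cnorm_ge0 v)) -mulrA.
  have [t0 t1] : 0 <= t /\ t <= 1 by lra.
  have pl : cnorm (t%:C *: v) `^ al <= cnorm v `^ al.
    apply: ge0_ler_powR; rewrite ?nnegrE ?cnorm_ge0 ?(ltW al0)// cnormZ cnorm_real ger0_norm//.
    by rewrite ler_piMl ?cnorm_ge0.
  have h : cnorm (t%:C *: v) `^ al * cnorm v <= cnorm v * cnorm v `^ al.
    by rewrite mulrC; apply: ler_wpM2l => //; exact: cnorm_ge0.
  apply: le_trans (ler_wpM2l (normr_ge0 M) h) _.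
  rewrite mulrDl mul1r mulrDl lerDr !mulr_ge0 ?cnorm_ge0 ?powR_ge0//.
- move=> z w v zx wx; rewrite -cdotBl.
  set u := cdot _ v.
  have h1 := HD z w v zx wx; have h2 := HD z w ((- 'i%C) *: v) zx wx.
  rewrite -cReB -cdotBl -/u in h1.
  rewrite -cReB -cdotBl cdotZr -/u cnormZ cnormN in h2.
  have Ei : Re (- 'i%C * u) = Im u by case: (u) => a b /=; ring.
  have ni : cnorm 'i%C = 1 :> R by rewrite cnorm_def /= expr0n expr1n add0r sqrtr1.
  rewrite Ei ni mul1r in h2.
  apply: le_trans (cnorm_le_ReIm _) _; apply: le_trans (lerD h1 h2) _.
  by rewrite -mulr2n -[leLHS]mulr_natl !mulrA.
- by move=> z zx; apply: Uin; exact: Urho.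
- by move=> z zx; apply: Ubd; exact: Urho.
- move=> z zx; have [|v v0] := Ugr (rvec z); first by rewrite rvecK; exact: Urho.
  exists (cvec v); apply: contra_neq v0 => /(congr1 (fun u : R[i] => Re u)).
  by rewrite AE cvecK.
Qed.

(** * Growth estimate near the boundary *)

Lemma powR_small (R : realType) (al C e : R) : 0 < al -> 0 <= C -> 0 < e ->
  exists2 d : R, 0 < d & forall s, 0 <= s -> s <= d -> C * s `^ al <= e.
Proof.
move=> al0 C0 e0; have C1 : 0 < C + 1 by lra.
have q0 : 0 < e / (C + 1) by exact: divr_gt0.
exists ((e / (C + 1)) `^ al^-1); first exact: powR_gt0.
move=> s s0 sd; have : s `^ al <= ((e / (C + 1)) `^ al^-1) `^ al.
  by apply: ge0_ler_powR => //; rewrite ?nnegrE ?powR_ge0// ltW.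
rewrite -powRrM mulVf ?lt0r_neq0// powRr1; last exact: ltW.
rewrite ler_pdivlMr// => h.
have : 0 <= s `^ al by exact: powR_ge0.
rewrite mulrDr mulr1 mulrC in h; lra.
Qed.

Lemma powR_max_le (R : realType) (p a b : R) : 0 <= p -> 0 <= a -> 0 <= b ->
  (Num.max a b) `^ p <= a `^ p + b `^ p.
Proof.
by move=> p0 a0 b0; case: (leP a b) => _; rewrite (lerDl, lerDr); exact: powR_ge0.
Qed.

Section chart_transversal.
Variables (R : realType) (d : nat) (al : R) (Om : set 'rV[R[i]]_d) (x : 'rV[R[i]]_d).
Variables (rho : R) (r : 'rV[R[i]]_d -> R) (A : 'rV[R[i]]_d -> 'rV[R[i]]_d) (M : R).
Hypothesis al0 : 0 < al.
Hypothesis chart : defining_chart al Om x rho r A M.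

Lemma chart_center : cnorm (x - x) < rho.
Proof. by rewrite subrr cnorm0; exact: chart_rho_gt0 chart. Qed.

Lemma chart_continuous_at z (e : R) : cnorm (z - x) < rho -> 0 < e ->
  exists2 del, 0 < del & forall w, cnorm (w - z) < del -> `|r w - r z| < e.
Proof.
move=> zx e0; have M0 := chart_M_ge0 chart.
have al10 : 0 < 1 + al by exact: addr_gt0.
have [d1 d10 H1] := powR_small al10 M0 (divr_gt0 e0 (ltr0Sn _ 2)).
pose N := d%:R * cnorm (A z) + 1.
have N0 : 0 < N by rewrite ltr_wpDl// mulr_ge0// cnorm_ge0.
have q0 : 0 < e / 3 / N by rewrite !divr_gt0.
exists (Num.min (e / 3 / N) (Num.min d1 (rho - cnorm (z - x)))).
  by rewrite !lt_min q0 d10 subr_gt0.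
move=> p; rewrite !lt_min => /and3P[p1 p2 p3].
have px : cnorm (p - x) < rho.
  have -> : p - x = (p - z) + (z - x) by rewrite addrA subrK.
  by apply: le_lt_trans (cnormD _ _) _; lra.
have := chart_taylor chart zx px.
have := H1 _ (cnorm_ge0 (p - z)) (ltW p2).
have : `|Re (cdot (A z) (p - z))| <= e / 3.
  apply: le_trans (Re_le_cnorm _) _; apply: le_trans (cnorm_cdot _ _) _.
  move: (ltW p1); rewrite ler_pdivlMr// /N; have := cnorm_ge0 (p - z); lra.
rewrite !ler_norml ltr_norml; lra.
Qed.

Lemma chart_continuous (e : R) : r x = 0 -> 0 < e -> exists2 del, 0 < del &
  forall p, cnorm (p - x) < del -> `|r p| < e.
Proof.
move=> rx0 e0; have [del del0 H] := chart_continuous_at chart_center e0.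
by exists del => // p /H; rewrite rx0 subr0.
Qed.

(* A field of directions that the complex gradient maps to -1: along it, r is
   to first order minus the real part of the complex parameter. *)
Lemma chart_transversal : exists (rho1 L : R) (u : 'rV[R[i]]_d -> 'rV[R[i]]_d),
  [/\ 0 < rho1 <= rho, 0 <= L,
    forall z, cnorm (z - x) < rho1 -> cdot (A z) (u z) = -1 /\ cnorm (u z) <= L &
    forall e, 0 < e -> exists2 del, 0 < del &
      forall z, cnorm (z - x) < del -> cnorm (u z - u x) < e].
Proof.
have rho0 := chart_rho_gt0 chart; have M0 := chart_M_ge0 chart.
have [v0 v0n] := chart_gradient chart chart_center.
pose c z := cdot (A z) v0.
set m := cnorm (cdot (A x) v0); have m0 : 0 < m by rewrite cnorm_gt0.
have n0 : 0 <= cnorm v0 by exact: cnorm_ge0.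
have cc e : 0 < e -> exists2 del, 0 < del <= rho & forall z, cnorm (z - x) < del -> cnorm (c z - c x) <= e.
  move=> e0; have [del del0 H] := powR_small al0 (mulr_ge0 M0 n0) e0.
  exists (Num.min del rho); first by rewrite lt_min del0 rho0 ge_min lexx orbT.
  move=> z; rewrite lt_min => /andP[z1 z2].
  apply: le_trans (chart_holder chart v0 z2 chart_center) _.
  by rewrite mulrAC; apply: H; [exact: cnorm_ge0|exact: ltW].
have [rho1 rho10 H1] := cc (m / 2) ltac:(lra).
have cm z : cnorm (z - x) < rho1 -> m / 2 <= cnorm (c z).
  move=> /H1 h; have := cnormBr (c x) (c x - c z).
  rewrite cdistrC in h; have -> : c x - (c x - c z) = c z by ring.
  rewrite /m -/(c x) in h *; lra.
have cn0 z : cnorm (z - x) < rho1 -> c z != 0.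
  by move=> /cm h; rewrite -cnorm_gt0; lra.
(* One fixed vector [v0], not annihilated by the gradient at [x], is rescaled by the inverse of
   [c z]; so [u] inherits the continuity of the gradient, and [m / 2 <= cnorm (c z)] bounds it. *)
exists rho1, (cnorm v0 / (m / 2)), (fun z => - (c z)^-1 *: v0); split => //.
- by rewrite divr_ge0//; lra.
- move=> z zx; rewrite cdotZr -/(c z) mulNr mulVf ?cn0//; split => //.
  rewrite cnormZ cnormN cnormV mulrC; apply: ler_wpM2l => //.
  by rewrite lef_pV2 ?posrE ?cm//; [rewrite cnorm_gt0 cn0|lra].
- move=> e e0; pose e1 := e * (m * (m / 2)) / (cnorm v0 + 1) / 2.
  have e10 : 0 < e1 by rewrite /e1 !divr_gt0 ?mulr_gt0 ?divr_gt0//; lra.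
  have [del /andP[del0 _] Hdel] := cc e1 e10.
  exists (Num.min del rho1); first by rewrite lt_min del0; case/andP: rho10.
  move=> z; rewrite lt_min => /andP[/Hdel h z1].
  have cx : cnorm (x - x) < rho1 by rewrite subrr cnorm0; case/andP: rho10.
  rewrite -scalerBl cnormZ.
  have -> : - (c z)^-1 - - (c x)^-1 = (c z - c x) / (c x * c z).
    by field; rewrite !cn0.
  rewrite cnormf cnormM -/m.
  have cz := cm z z1.
  have D0 : 0 < m * cnorm (c z) by apply: mulr_gt0 => //; lra.
  rewrite mulrAC ltr_pdivrMr//.
  apply: (@le_lt_trans _ _ (e1 * (cnorm v0 + 1))).
    by apply: ler_pM; rewrite ?cnorm_ge0//; lra.
  have -> : e1 * (cnorm v0 + 1) = e * (m * (m / 2)) / 2.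
    by rewrite /e1; field; apply: lt0r_neq0; lra.
  have : e * (m * (m / 2)) <= e * (m * cnorm (c z)) by rewrite ler_pM2l// ler_pM2l.
  have : 0 < e * (m * (m / 2)) by rewrite !mulr_gt0// divr_gt0.
  lra.
Qed.

End chart_transversal.

(** Differentiability along complex lines suffices, as each disc of the growth estimate lies in a
    single complex line. *)
Definition line_holomorphic (R : realType) (d : nat) (Om : set 'rV[R[i]]_d) (h : 'rV[R[i]]_d -> R[i]) :=
  forall (p v : 'rV[R[i]]_d) (t : R[i]), Om (p + t *: v) -> derivable (fun s : R[i] => h (p + s *: v)) t 1.

Section chart_growth.
Variables (R : realType) (d : nat) (al : R) (Om : set 'rV[R[i]]_d) (x : 'rV[R[i]]_d).
Variables (rho : R) (r : 'rV[R[i]]_d -> R) (A : 'rV[R[i]]_d -> 'rV[R[i]]_d) (M : R).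
Hypotheses (al0 : 0 < al) (al1 : al <= 1).
Hypothesis chart : defining_chart al Om x rho r A M.
Hypothesis rx0 : r x = 0.

(* The holomorphic disc [w |-> p + (phi w - phi s) u_p], [s = - r p],
   [|w - t| < t], stays in [Om], maps [s] to [p] and [t] to [tau p t]. *)
Lemma chart_growth : exists (rho1 t0 : R) (tau : 'rV[R[i]]_d -> R -> 'rV[R[i]]_d),
  [/\ 0 < rho1 <= rho, 0 < t0,
    forall p t, cnorm (p - x) < rho1 -> 0 <= - r p -> - r p <= t -> 0 < t -> t <= t0 -> Om (tau p t),
    forall p t h, cnorm (p - x) < rho1 -> 0 < - r p -> - r p <= t -> t <= t0 ->
      line_holomorphic Om h -> (forall z, Om z -> 0 < Re (h z)) ->
      cnorm (h (tau p t)) <= 2 * t / (- r p) * cnorm (h p) &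
    forall t e, 0 < e -> exists2 del, 0 < del &
      forall p, cnorm (p - x) < del -> 0 <= - r p -> cnorm (tau p t - tau x t) < e].
Proof.
have tau_diff (a b : R[i]) (p q v w : 'rV[R[i]]_d) :
    p + (a - b) *: v - (q + a *: w) = p - q + (a - b) *: (v - w) - b *: w.
  by apply/rowP => j; rewrite !mxE; ring.
have rho0 := chart_rho_gt0 chart; have M0 := chart_M_ge0 chart.
have [rho2 [L [u [/andP[rho20 rho2l] L0 Hu uc]]]] := chart_transversal al0 chart.
(* The displacement on the disc is at most [2 * (cnorm w + s) * L], hence at most [4 * L] times the
   larger of [cnorm w] and [s]; [M2] is the resulting Taylor constant. *)
pose M2 := M * (4 * L) `^ (1 + al).
have M20 : 0 <= M2 by rewrite mulr_ge0// powR_ge0.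
have [phi [t1 [K [t10 KM Hphi phis]]]] := @curved_halfplane R al M2 al0 al1 M20.
have K0 : 0 <= K by exact: le_trans KM.
pose ph (s : R) := s - K * s `^ (1 + al).
pose rho1 := Num.min rho2 (rho / 2).
(* Points of the disc satisfy [cnorm w <= 2 * t0 <= t1]. The displacement is at most [6 * t0 * L],
   which the factor 14 keeps below [rho / 2]; the centre [p] uses the other half. *)
pose t0 := Num.min (t1 / 2) (rho / (14 * (L + 1))).
have al1p : 0 < 1 + al by exact: addr_gt0.
have al10 : 1 + al != 0 by exact: lt0r_neq0.
have al1w := ltW al1p.
have ph0 : ph 0 = 0 by rewrite /ph powR0// mulr0 subr0.
have rho10 : 0 < rho1 by rewrite lt_min rho20 divr_gt0.
have [r1 r2] : rho1 <= rho2 /\ rho1 <= rho / 2 by rewrite !ge_min !lexx orbT.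
have t00 : 0 < t0 by rewrite lt_min !divr_gt0// mulr_gt0//; lra.
have [tt1 tL] : 2 * t0 <= t1 /\ t0 * (14 * (L + 1)) <= rho.
  split; first by have : t0 <= t1 / 2 by [rewrite ge_min lexx]; lra.
  by rewrite -ler_pdivlMr ?ge_min ?lexx ?orbT// mulr_gt0//; lra.
have phbound s : 0 <= s -> s <= t1 -> `|ph s| <= 2 * s.
  move=> s0 st; have [->|sn0] := eqVneq s 0; first by rewrite ph0 normr0 mulr0.
  have sgt0 : 0 < s by rewrite lt_def sn0.
  have [|_ _] := Hphi s%:C sgt0; first by rewrite cnorm_real ger0_norm.
  by rewrite phis// !cnorm_real (ger0_norm s0).
pose psi p w := p + (phi w - (ph (- r p))%:C) *: u p.
have psi_in p t w : cnorm (p - x) < rho1 -> 0 <= - r p -> - r p <= t -> t <= t0 ->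
    0 < Re w -> cnorm w <= 2 * t -> Om (psi p w).
  move=> px s0 st tt w0 wt; set s := - r p in s0 st *.
  have wt1 : cnorm w <= t1 by lra.
  have [_ phiRe phin] := Hphi w w0 wt1.
  set z := phi w - (ph s)%:C.
  have zn : cnorm z <= 2 * (cnorm w + s).
    apply: le_trans (cnormB _ _) _; rewrite cnorm_real.
    have := phbound s s0 ltac:(lra); lra.
  have [cu uL] := Hu p (lt_le_trans px r1).
  have zu : cnorm (z *: u p) <= 2 * (cnorm w + s) * L.
    by rewrite cnormZ; apply: ler_pM; rewrite ?cnorm_ge0.
  have pxr : cnorm (p - x) < rho by lra.
  have psix : cnorm (psi p w - x) < rho.
    rewrite /psi -/s -/z addrAC; apply: le_lt_trans (cnormD _ _) _.
    have : 2 * (cnorm w + s) * L <= 2 * (3 * t0) * L by apply: ler_wpM2r => //; lra.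
    have : 0 <= t0 * L by rewrite mulr_ge0// ltW.
    lra.
  apply/(chart_inside chart psix).
  have := chart_taylor chart pxr psix.
  have -> : psi p w - p = z *: u p by rewrite /psi -/s -/z addrAC subrr add0r.
  rewrite cdotZr cu mulrN1 cReN => taylor.
  have n0 := cnorm_ge0 w.
  have pow : M * cnorm (z *: u p) `^ (1 + al) <= M2 * (cnorm w `^ (1 + al) + s `^ (1 + al)).
    rewrite /M2 -mulrA; apply: ler_wpM2l => //.
    apply: (@le_trans _ _ ((4 * L * Num.max (cnorm w) s) `^ (1 + al))).
      apply: ge0_ler_powR; rewrite ?nnegrE ?cnorm_ge0//.
        by rewrite !mulr_ge0// le_max n0.
      apply: le_trans zu _; rewrite -[4 * L * _]mulrA [L * _]mulrC mulrA; apply: ler_wpM2r => //.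
      have : cnorm w <= Num.max (cnorm w) s by rewrite le_max lexx.
      have : s <= Num.max (cnorm w) s by rewrite le_max lexx orbT.
      lra.
    rewrite powRM ?mulr_ge0 ?le_max ?n0//; apply: ler_wpM2l; first exact: powR_ge0.
    exact: powR_max_le.
  (* The subtracted [ph s] leaves [- K] times the power [1 + al] of [s]. As [M2 <= K], this
     compensates the part of the Taylor error due to [s]; the part due to [w] is compensated by the
     bend. *)
  have : M2 * s `^ (1 + al) <= K * s `^ (1 + al) by apply: ler_wpM2r => //; exact: powR_ge0.
  move: taylor phiRe pow; rewrite /z cReB /= /ph ler_norml /s.
  set q := cnorm w `^ _; set q' := (- r p) `^ _; lra.
(* With the real profile [ph], continuity in [p] at [x] reduces to [ph] being small near 0 and [u]
   being continuous at [x]; the value at [s = 0] is included. *)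
pose tau p (t : R) := p + (ph t - ph (- r p))%:C *: u p.
have tauE p t : 0 < t -> tau p t = psi p t%:C.
  by move=> tgt0; rewrite /psi /tau (phis t tgt0) -rmorphB.
exists rho1, t0, tau; split => //.
- by rewrite rho10 (le_trans r1).
- move=> p t px s0 st tgt0 tt; rewrite tauE//; apply: psi_in st tt _ _ => //.
  by rewrite cnorm_real gtr0_norm//; lra.
- move=> p t h px s0 st tt hh hpos; have tgt0 : 0 < t by lra.
  have disc w : cnorm (w - t%:C) < t -> 0 < Re w /\ cnorm w < 2 * t.
    move=> wt; split.
      have := le_lt_trans (Re_le_cnorm _) wt; rewrite cReB /= ltr_norml; lra.
    have := cnormD (w - t%:C) t%:C; rewrite subrK cnorm_real gtr0_norm//; lra.
  have hp : psi p (- r p)%:C = p by rewrite /psi phis// subrr scale0r addr0.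
  rewrite (tauE _ _ tgt0).
  have := @halfplane_disc_growth R (fun w => h (psi p w)) (- r p) t; rewrite hp; apply => //.
  + move=> w /disc[w0 wt]; have [phid _ _] := Hphi w w0 ltac:(lra).
    have hd : is_derive (phi w - (ph (- r p))%:C) 1 (fun s : R[i] => h (p + s *: u p))
        ('D_1 (fun s : R[i] => h (p + s *: u p)) (phi w - (ph (- r p))%:C)).
      exact: (DeriveDef (hh p (u p) _ (psi_in p t w px (ltW s0) st tt w0 (ltW wt))) (erefl _)).
    have pD : is_derive w 1 (fun w => phi w - (ph (- r p))%:C) ('D_1 phi w).
      have /cderiv_epsP H : is_derive w 1 phi ('D_1 phi w) by exact: (DeriveDef phid (erefl _)).
      apply/cderiv_epsP => e e0; have [del del0 Hdel] := H e e0; exists del => // w' /Hdel.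
      by have -> : phi w' - (ph (- r p))%:C - (phi w - (ph (- r p))%:C) = phi w' - phi w by ring.
    by have [] := @cderiv_comp R _ (fun w : R[i] => phi w - (ph (- r p))%:C) w _ _ hd pD.
  + move=> w /disc[w0 wt]; apply: hpos; exact: (psi_in p t w px (ltW s0) st tt w0 (ltW wt)).
- move=> t e e0; pose B := `|ph t| + 1; have B0 : 0 < B by rewrite ltr_wpDl.
  have [d1 d10 H1] := uc (e / 4 / B) ltac:(by rewrite !divr_gt0).
  pose s1 := Num.min (t1 / 2) (Num.min (1 / 2) (e / (8 * (L + 1)))).
  have s10 : 0 < s1 by rewrite !lt_min !divr_gt0// mulr_gt0//; lra.
  have [s1t s1h s1e] : [/\ s1 <= t1 / 2, s1 <= 1 / 2 & s1 * (8 * (L + 1)) <= e].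
    split; rewrite ?ge_min ?lexx ?orbT//.
    by rewrite -ler_pdivlMr ?ge_min ?lexx ?orbT// mulr_gt0//; lra.
  have [d2 d20 H2] := chart_continuous al0 chart rx0 s10.
  exists (Num.min (e / 4) (Num.min d1 d2)); first by rewrite !lt_min d10 d20 divr_gt0.
  move=> p; rewrite !lt_min => /and3P[pe /H1 hu /H2]; rewrite ltr_norml => /andP[rp _] s0.
  have phs : `|ph (- r p)| <= 2 * (- r p) by apply: phbound => //; lra.
  have -> : tau p t - tau x t = (p - x) + (ph t - ph (- r p))%:C *: (u p - u x)
      - (ph (- r p))%:C *: u x.
    by rewrite /tau rx0 oppr0 ph0 subr0 rmorphB tau_diff.
  apply: le_lt_trans (cnormB _ _) _.
  apply: le_lt_trans (lerD (cnormD _ _) (lexx _)) _.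
  rewrite !cnormZ !cnorm_real.
  have [_ uxL] : cdot (A x) (u x) = -1 /\ cnorm (u x) <= L by apply: Hu; rewrite subrr cnorm0.
  have h1 : `|ph (- r p)| * cnorm (u x) <= 2 * s1 * L.
    by apply: ler_pM; rewrite ?cnorm_ge0//; lra.
  have h2 : `|ph t - ph (- r p)| * cnorm (u p - u x) <= B * (e / 4 / B).
    apply: ler_pM; rewrite ?cnorm_ge0//; last exact: ltW.
    by apply: le_trans (ler_normB _ _) _; rewrite /B; lra.
  have BB : B * (e / 4 / B) = e / 4 by field; exact: lt0r_neq0.
  have : 0 <= s1 * L by rewrite mulr_ge0// ltW.
  lra.
Qed.

End chart_growth.

(** * Supporting functionals and nearby boundary points *)

Section convex_sets.
Variables (R : realType) (d : nat).
Implicit Types (Om : set 'rV[R[i]]_d) (z w b : 'rV[R[i]]_d).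

Lemma convex_set_segment Om z w (t : R) : convex_set Om -> Om z -> Om w ->
  0 <= t -> t <= 1 -> Om (w + t%:C *: (z - w)).
Proof.
move=> cOm Oz Ow t0 t1.
have tc0 : 0 <= t%:C :> R[i] by rewrite ler0c.
have tc1 : t%:C <= 1 :> R[i] by rewrite -[1]/(1%:C) lecR.
have := cOm z w (Itv01 tc0 tc1) (mem_set Oz) (mem_set Ow).
rewrite inE; congr (Om _).
rewrite /conv /= /unstable.onem scalerBl scale1r scalerBr.
by rewrite addrCA.
Qed.

Lemma closure_cnormP Om b :
  closure Om b <-> forall e : R, 0 < e -> exists2 z, Om z & cnorm (z - b) < e.
Proof.
split=> [cb e e0|H B /nbhs_cnormP[e e0 He]].
  have [|z [Oz zb]] := cb [set z | cnorm (z - b) < e]; last by exists z.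
  by apply/nbhs_cnormP; exists e.
by have [z Oz zb] := H e e0; exists z; split => //; exact: He.
Qed.

Lemma open_cnormP Om : open Om <->
  forall z, Om z -> exists2 e : R, 0 < e & forall w, cnorm (w - z) < e -> Om w.
Proof.
rewrite openE; split=> H z Oz.
  by have /nbhs_cnormP := H z Oz.
by apply/nbhs_cnormP; exact: H.
Qed.

Lemma boundary_openP Om b : open Om -> (boundary Om b <-> closure Om b /\ ~ Om b).
Proof.
by move=> oOm; rewrite /boundary; have /interior_id -> := oOm.
Qed.

Lemma closure_openP Om b : open Om -> closure Om b -> Om b \/ boundary Om b.
Proof.
move=> oOm cb; have [Ob|nOb] := pselect (Om b); first by left.
by right; apply/boundary_openP.
Qed.

Lemma closure_segment Om z b (t : R) : convex_set Om -> Om z -> closure Om b ->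
  0 <= t -> t <= 1 -> closure Om (b + t%:C *: (z - b)).
Proof.
move=> cOm Oz /closure_cnormP cb t0 t1; apply/closure_cnormP => e e0.
have [w Ow wb] := cb e e0; exists (w + t%:C *: (z - w)); first exact: convex_set_segment.
have -> : w + t%:C *: (z - w) - (b + t%:C *: (z - b)) = (1 - t)%:C *: (w - b).
  rewrite rmorphB /= scalerBl scale1r !scalerBr.
  by apply/rowP => j; rewrite !mxE; ring.
rewrite cnormZ cnorm_real ger0_norm; last by lra.
by apply: le_lt_trans wb; apply: ler_piMl; [exact: cnorm_ge0|lra].
Qed.

End convex_sets.

Section chart_facts.
Variables (R : realType) (d : nat) (al : R) (Om : set 'rV[R[i]]_d) (x : 'rV[R[i]]_d).
Variables (rho : R) (r : 'rV[R[i]]_d -> R) (A : 'rV[R[i]]_d -> 'rV[R[i]]_d) (M : R).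
Hypothesis al0 : 0 < al.
Hypothesis chart : defining_chart al Om x rho r A M.

(** The gradient at a boundary point of a convex set supports it: a positive derivative towards a
    point of [Om] would make [r] positive on a segment contained in the closure. Openness of [Om]
    makes the inequality strict. *)
Lemma chart_supporting b z : open Om -> convex_set Om ->
  cnorm (b - x) < rho -> boundary Om b -> Om z -> Re (cdot (A b) (z - b)) < 0.
Proof.
move=> oOm cOm bx bb.
have M0 := chart_M_ge0 chart.
have rb : r b = 0 by apply/(chart_boundary chart bx).
have cb : closure Om b by case: bb.
have weak w : Om w -> Re (cdot (A b) (w - b)) <= 0.
  move=> Ow; rewrite leNgt; apply/negP => pos.
  set k := Re _ in pos; set n := cnorm (w - b).
  have n0 : 0 <= n by exact: cnorm_ge0.
  have C0 : 0 <= M * n `^ (1 + al) by rewrite mulr_ge0// powR_ge0.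
  (* For [t <= e] the Taylor error at distance [t] along the segment is at most half of the linear
     term [t * k], so [r] would be positive there. *)
  have [e e0 He] := powR_small al0 C0 (divr_gt0 pos (ltr0Sn _ 1)).
  have n1 : 0 < n + 1 by lra.
  pose t := Num.min (Num.min 1 e) ((rho - cnorm (b - x)) / 2 / (n + 1)).
  have t0 : 0 < t by rewrite !lt_min ltr01 e0 !divr_gt0// subr_gt0.
  have [t1 te tn] : [/\ t <= 1, t <= e & t * (n + 1) <= (rho - cnorm (b - x)) / 2].
    split; rewrite ?ge_min ?lexx ?orbT//.
    by rewrite -ler_pdivlMr// ge_min lexx orbT.
  pose c := b + t%:C *: (w - b).
  have cbE : c - b = t%:C *: (w - b) by rewrite /c addrAC subrr add0r.
  have cn : cnorm (c - b) = t * n by rewrite cbE cnormZ cnorm_real gtr0_norm.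
  have cx : cnorm (c - x) < rho.
    have -> : c - x = (c - b) + (b - x) by rewrite addrA subrK.
    by apply: le_lt_trans (cnormD _ _) _; rewrite cn; lra.
  have rc : r c <= 0.
    have [] := closure_openP oOm (closure_segment cOm Ow cb (ltW t0) t1).
      by move=> /(chart_inside chart cx)/ltW.
    by move=> /(chart_boundary chart cx) ->.
  have := chart_taylor chart bx cx; rewrite rb subr0 cn cbE cdotZr.
  rewrite cReM /= mul0r subr0 -/k powRM ?(ltW t0)//.
  rewrite (powRD (x := t)) ?powRr1 ?(ltW t0)//; last by rewrite lt0r_neq0// implybT.
  have h := He t (ltW t0) te.
  have -> : M * (t * t `^ al * n `^ (1 + al)) = t * (M * n `^ (1 + al) * t `^ al) by ring.
  have h2 : t * (M * n `^ (1 + al) * t `^ al) <= t * (k / 2) by rewrite ler_pM2l.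
  have tk : 0 < t * k by exact: mulr_gt0.
  rewrite ler_norml; lra.
(* If equality held at [z], a small step along [v1], on which the functional is 1, would violate the
   weak inequality inside [Om]. *)
move=> Oz; have [v vn] := chart_gradient chart bx.
have [e e0 He] := (open_cnormP Om).1 oOm z Oz.
pose v1 := (cdot (A b) v)^-1 *: v.
have v1E : cdot (A b) v1 = 1 by rewrite cdotZr mulVf.
have n1 : 0 < cnorm v1 + 1 by have := cnorm_ge0 v1; lra.
pose s := e / (cnorm v1 + 1) / 2.
have s0 : 0 < s by rewrite !divr_gt0.
have := weak (z + s%:C *: v1).
rewrite addrAC cdotDr cdotZr v1E mulr1 cReD /= => h.
suff : Om (z + s%:C *: v1) by move=> /h; lra.
apply: He; rewrite addrAC subrr add0r cnormZ cnorm_real gtr0_norm//.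
have -> : s * cnorm v1 = e / 2 * (cnorm v1 / (cnorm v1 + 1)).
  by rewrite /s; field; exact: lt0r_neq0.
have : cnorm v1 / (cnorm v1 + 1) <= 1 by rewrite ler_pdivrMr//; lra.
move=> /(ler_wpM2l (_ : 0 <= e / 2)) q; have := q ltac:(lra); lra.
Qed.

Lemma chart_gradient_bound : exists2 B, 0 <= B &
  forall z v, cnorm (z - x) < rho -> cnorm (cdot (A z) v) <= B * cnorm v.
Proof.
have M0 := chart_M_ge0 chart; have rho0 := chart_rho_gt0 chart.
exists (d%:R * cnorm (A x) + M * rho `^ al).
  by rewrite addr_ge0// mulr_ge0 ?cnorm_ge0// powR_ge0.
move=> z v zx; have n0 := cnorm_ge0 v.
rewrite -[cdot (A z) v](subrK (cdot (A x) v)) mulrDl addrC.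
apply: le_trans (cnormD _ _) _; apply: lerD; first exact: cnorm_cdot.
apply: le_trans (chart_holder chart v zx (chart_center chart)) _.
apply: ler_wpM2r => //; apply: ler_wpM2l => //.
by apply: ge0_ler_powR; rewrite ?nnegrE ?cnorm_ge0 ?(ltW al0) ?(ltW rho0)// ltW.
Qed.

(** Joint continuity in base point and argument; it carries estimates from supporting functionals at
    nearby boundary points to the one at the limit point. *)
Lemma chart_functional_limit b w : cnorm (b - x) < rho -> forall e, 0 < e ->
  exists2 del, 0 < del & forall b' w', cnorm (b' - b) < del -> cnorm (w' - w) < del ->
    cnorm (cdot (A b') (w' - b') - cdot (A b) (w - b)) <= e.
Proof.
move=> bx e e0; have M0 := chart_M_ge0 chart.
have [B B0 HB] := chart_gradient_bound.
have n0 : 0 <= cnorm (w - b) by exact: cnorm_ge0.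
have [d1 d10 H1] := powR_small al0 (mulr_ge0 M0 n0) (divr_gt0 e0 (ltr0Sn _ 1)).
have B1 : 0 < B + 1 by lra.
pose d2 := e / 4 / (B + 1).
have d20 : 0 < d2 by rewrite !divr_gt0.
have d2e : d2 * (B + 1) = e / 4 by rewrite divfK// lt0r_neq0.
exists (Num.min (rho - cnorm (b - x)) (Num.min d1 d2)).
  by rewrite !lt_min subr_gt0 bx d10 d20.
move=> b' w'; rewrite !lt_min => /and3P[b1 b2 b3] /and3P[_ _ w3].
have b'x : cnorm (b' - x) < rho.
  have -> : b' - x = (b' - b) + (b - x) by rewrite addrA subrK.
  by apply: le_lt_trans (cnormD _ _) _; lra.
have -> : cdot (A b') (w' - b') - cdot (A b) (w - b) =
    cdot (A b') ((w' - w) - (b' - b)) + (cdot (A b') (w - b) - cdot (A b) (w - b)).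
  have E : w' - b' = (w' - w - (b' - b)) + (w - b).
    by apply/rowP => j; rewrite !mxE; ring.
  by rewrite {1}E cdotDr addrA.
apply: le_trans (cnormD _ _) _.
have h1 : cnorm (cdot (A b') (w' - w - (b' - b))) <= B * (2 * d2).
  apply: le_trans (HB _ _ b'x) _; apply: ler_wpM2l => //.
  by apply: le_trans (cnormB _ _) _; lra.
have h2 : cnorm (cdot (A b') (w - b) - cdot (A b) (w - b)) <= e / 2.
  apply: le_trans (chart_holder chart (w - b) b'x bx) _.
  by rewrite mulrAC; apply: H1; [exact: cnorm_ge0|exact: ltW].
have : B * (2 * d2) <= e / 2 by lra.
lra.
Qed.

(* Moving from p in the direction v, along which r grows at least like s / 2,
   one meets the boundary at a distance comparable to - r p. *)
Lemma chart_foot : r x = 0 -> exists2 C, 0 <= C &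
  forall e, 0 < e -> exists2 del, 0 < del &
    forall p, cnorm (p - x) < del -> r p <= 0 -> exists b,
      [/\ cnorm (b - x) < e, cnorm (b - x) < rho, boundary Om b & cnorm (p - b) <= C * - r p].
Proof.
move=> rx0; have near1 (k : R) : - (1 / 4) <= k - 1 <= 1 / 4 -> 3 / 4 <= k by lra.
have descend (F q s k X : R) : q = - s / 2 -> `|F - q - s * k| <= X ->
    X <= s * (1 / 4) -> s * (3 / 4) <= s * k -> 0 <= F.
  by move=> -> ; rewrite ler_norml; lra.
have M0 := chart_M_ge0 chart; have rho0 := chart_rho_gt0 chart.
have [v0 v0n] := chart_gradient chart (chart_center chart).
pose v := (cdot (A x) v0)^-1 *: v0.
have vE : cdot (A x) v = 1 by rewrite cdotZr mulVf.
set n := cnorm v; have n0 : 0 <= n by exact: cnorm_ge0.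
have q4 : 0 < 1 / 4 :> R by lra.
have [d1 d10 H1] := powR_small al0 (mulr_ge0 M0 n0) q4.
have C0 : 0 <= M * n `^ (1 + al) by rewrite mulr_ge0// powR_ge0.
have [s0 s00 Hs] := powR_small al0 C0 q4.
exists (2 * n); first by rewrite mulr_ge0.
move=> e e0; have n1 : 0 < n + 1 by lra.
pose s1 := Num.min s0 (Num.min (rho / 2 / (n + 1)) (e / 2 / (n + 1))).
have s10 : 0 < s1 by rewrite !lt_min s00 !divr_gt0.
have [s1s s1r s1e] : [/\ s1 <= s0, s1 * (n + 1) <= rho / 2 & s1 * (n + 1) <= e / 2].
  by split; rewrite -?ler_pdivlMr// !ge_min !lexx ?orbT.
have [d2 d20 H2] := chart_continuous al0 chart rx0 (divr_gt0 s10 (ltr0Sn _ 1)).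
pose del := Num.min (Num.min d1 d2) (Num.min (rho / 2) (e / 2)).
exists del; first by rewrite !lt_min d10 d20 !divr_gt0.
move=> p; rewrite !lt_min => /andP[/andP[p1 p2] /andP[p3 p4]] rp.
have px : cnorm (p - x) < rho by lra.
have := H2 p p2; rewrite ltr_norml => /andP[rps _].
(* The slope along [v] is at least 3/4 and the Taylor error costs at most 1/4, so [r] gains at least
   [S / 2 = - r p] over the length [S] and becomes nonnegative. *)
pose S := 2 * - r p; have S0 : 0 <= S by rewrite /S; lra.
have Ss1 : S <= s1 by rewrite /S; lra.
have line (s : R) : 0 <= s -> s <= S -> cnorm (p + s%:C *: v - x) < rho /\ cnorm (p + s%:C *: v - x) < e.
  move=> s_ge0 sS; have h : cnorm (p + s%:C *: v - x) <= cnorm (p - x) + s * n.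
    by rewrite addrAC; apply: le_trans (cnormD _ _) _; rewrite cnormZ cnorm_real ger0_norm.
  have h2 : s * n <= s1 * n by apply: ler_wpM2r => //; exact: le_trans Ss1.
  have fit B : cnorm (p - x) < B / 2 -> s1 * (n + 1) <= B / 2 -> cnorm (p + s%:C *: v - x) < B.
    move=> pB sB; apply: le_lt_trans h _; rewrite [B]splitr; apply: ltr_leD => //.
    by apply: le_trans h2 (le_trans _ sB); rewrite mulrDr mulr1 lerDl ltW.
  by split; exact: fit.
have ReA : 3 / 4 <= Re (cdot (A p) v).
  have := chart_holder chart v px (chart_center chart); rewrite vE.
  have := H1 _ (cnorm_ge0 (p - x)) (ltW p1); rewrite mulrAC => h1 h2.
  have := le_trans (Re_le_cnorm _) (le_trans h2 h1); rewrite cReB [Re 1]/= ler_norml.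
  exact: near1.
pose f (s : R) := r (p + s%:C *: v).
have f0 : f 0 = r p by rewrite /f scale0r addr0.
have fS : 0 <= f S.
  have [SE|Sn0] := eqVneq S 0.
    by rewrite SE f0; rewrite /S in SE; lra.
  have Sgt0 : 0 < S by rewrite lt_def Sn0.
  have [Sx _] := line S S0 (lexx _).
  have := chart_taylor chart px Sx; rewrite -/(f S).
  have -> : p + S%:C *: v - p = S%:C *: v by rewrite addrAC subrr add0r.
  rewrite cdotZr cReM [Re S%:C]/= [Im S%:C]/= mul0r subr0 cnormZ cnorm_real (ger0_norm S0) -/n powRM//.
  rewrite (powRD (x := S)) ?powRr1//; last by rewrite Sn0 implybT.
  have h := Hs S S0 (le_trans Ss1 s1s).
  have -> : M * (S * S `^ al * n `^ (1 + al)) = S * (M * n `^ (1 + al) * S `^ al) by ring.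
  have h2 : S * (M * n `^ (1 + al) * S `^ al) <= S * (1 / 4) by rewrite ler_pM2l.
  have h3 : S * (3 / 4) <= S * Re (cdot (A p) v) by rewrite ler_pM2l.
  move=> taylor; apply: (descend _ _ _ _ _ _ taylor h2 h3); rewrite /S; by field.
have fc (s : R) : 0 <= s -> s <= S -> {for s, continuous f}.
  move=> s_ge0 sS; have [sx _] := line s s_ge0 sS.
  apply/cvgrPdist_lt => e1 e10; have [d3 d30 H3] := chart_continuous_at al0 chart sx e10.
  apply/nbhs_normP; exists (d3 / (n + 1)); first by rewrite /= divr_gt0.
  move=> s' /= ss'; rewrite distrC; apply: H3.
  have -> : p + s'%:C *: v - (p + s%:C *: v) = (s' - s)%:C *: v.
    by rewrite rmorphB scalerBl; apply/rowP => j; rewrite !mxE; ring.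
  rewrite cnormZ cnorm_real distrC; move: ss'; rewrite ltr_pdivlMr//.
  by apply: le_lt_trans; apply: ler_wpM2l => //; rewrite lerDl.
have [||s] := @IVT R f 0 S 0 S0.
- apply: continuous_in_subspaceT => s; rewrite inE /= in_itv /= => /andP[h1 h2]; exact: fc.
- by rewrite f0 ge_min rp le_max fS orbT.
rewrite in_itv /= => /andP[s_ge0 sS] fs; exists (p + s%:C *: v).
have [sx se] := line s s_ge0 sS; split => //.
- exact/(chart_boundary chart sx).
- rewrite opprD addrA subrr add0r cnormN cnormZ cnorm_real ger0_norm//.
  by apply: le_trans (ler_wpM2r n0 sS) _; rewrite /S mulrAC.
Qed.

End chart_facts.

(** * Cluster values of the map *)

Lemma cdotNl (R : rcfType) (d : nat) (a v : 'rV[R[i]]_d) : cdot (- a) v = - cdot a v.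
Proof. by rewrite -[- a]sub0r cdotBl /cdot big1 ?sub0r// => j _; rewrite mxE mul0r. Qed.

Section holomorphic_maps.
Variables (R : realType) (d : nat) (Om : set 'rV[R[i]]_d) (f : 'rV[R[i]]_d -> 'rV[R[i]]_d).
Hypothesis fh : holomorphic_on Om f.

Lemma holomorphic_eps z : Om z -> forall e, 0 < e -> exists2 del, 0 < del &
  forall w, cnorm (w - z) < del -> cnorm (f w - f z) < e.
Proof.
move=> Oz e e0; have fc := differentiable_continuous (fh Oz).
have B : nbhs (f z) [set w | cnorm (w - f z) < e] by apply/nbhs_cnormP; exists e.
have /nbhs_cnormP[del del0 H] : nbhs z (f @^-1` [set w | cnorm (w - f z) < e]) by exact: fc.
by exists del.
Qed.

Lemma line_holomorphic_functional a b : line_holomorphic Om (fun z => cdot a (f z - b)).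
Proof.
move=> p v t Ot; have /is_derive_epsP := is_derive_line (fh Ot).
set l := 'd _ _ _ => H.
suff : is_derive t 1 (fun s : R[i] => cdot a (f (p + s *: v) - b)) (cdot a l) by case.
apply/cderiv_epsP => e e0; pose N := d%:R * cnorm a + 1.
have N0 : 0 < N by rewrite ltr_wpDl// mulr_ge0// cnorm_ge0.
have eN : 0 < e / N by exact: divr_gt0.
have eN' : 0 < (e / N)%:C :> R[i] by rewrite -[0]/(0%:C) ltcR.
have /nbhs_cnormP[del del0 Hd] := H _ eN'; exists del => // w /Hd {Hd}.
rewrite !cnormE -rmorphM lecR => h.
have -> : cdot a (f (p + w *: v) - b) - cdot a (f (p + t *: v) - b) - cdot a l * (w - t) =
    cdot a (f (p + w *: v) - f (p + t *: v) - (w - t) *: l).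
  by rewrite !cdotBr cdotZr opprB addrA subrK [cdot a l * _]mulrC.
apply: le_trans (cnorm_cdot _ _) _.
apply: (@le_trans _ _ (N * (e / N * cnorm (w - t)))).
  by apply: ler_pM; rewrite ?mulr_ge0 ?cnorm_ge0// /N lerDl.
by rewrite mulrA mulrCA mulfV ?mulr1// lt0r_neq0.
Qed.

End holomorphic_maps.

Definition cluster_value (R : realType) (d : nat) (Om : set 'rV[R[i]]_d)
    (f : 'rV[R[i]]_d -> 'rV[R[i]]_d) (x y : 'rV[R[i]]_d) :=
  forall e, 0 < e -> exists p, [/\ Om p, cnorm (p - x) < e & cnorm (f p - y) < e].

Section cluster_values.
Variables (R : realType) (d : nat) (al : R) (Om1 Om2 : set 'rV[R[i]]_d).
Variables (f g : 'rV[R[i]]_d -> 'rV[R[i]]_d).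
Hypotheses (al0 : 0 < al) (al1 : al <= 1).
Hypotheses (oOm1 : open Om1) (cOm1 : convex_set Om1).
Hypotheses (oOm2 : open Om2) (cOm2 : convex_set Om2).
Hypotheses (fh : holomorphic_on Om1 f) (gh : holomorphic_on Om2 g).
Hypotheses (f12 : forall z, Om1 z -> Om2 (f z)) (g21 : forall w, Om2 w -> Om1 (g w)).
Hypothesis fK : forall z, Om1 z -> g (f z) = z.

(** Properness of a biholomorphism: if [y] were in [Om2], continuity of the inverse at [y] would
    give [x = g y], a point of [Om1]. *)
Lemma cluster_value_boundary x y : boundary Om1 x -> cluster_value Om1 f x y -> boundary Om2 y.
Proof.
move=> /(boundary_openP x oOm1)[_ nx] cy; apply/(boundary_openP y oOm2); split.
  by apply/closure_cnormP => e /cy[p [Op _ py]]; exists (f p) => //; exact: f12.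
move=> Oy; apply: nx; suff -> : x = g y by exact: g21.
apply/eqP; rewrite -subr_eq0 -cnorm_eq0 eq_le cnorm_ge0 andbT.
apply/ler_addgt0Pr => e e0; rewrite add0r.
have e2 : 0 < e / 2 by exact: divr_gt0.
have [del del0 H] := holomorphic_eps gh Oy e2.
have m0 : 0 < Num.min (e / 2) del by rewrite lt_min e2.
have [p [Op]] := cy _ m0; rewrite !lt_min => /andP[px _] /andP[_ /H]; rewrite fK// => py.
have -> : x - g y = (p - g y) - (p - x) by rewrite opprB [RHS]addrC addrA subrK.
by apply: le_trans (cnormB _ _) _; move: px py; rewrite [e in leRHS]splitr => /ltW a /ltW b; exact: lerD.
Qed.

Section at_boundary_points.
Variables (x : 'rV[R[i]]_d) (rho1 : R) (r1 : 'rV[R[i]]_d -> R).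
Variables (A1 : 'rV[R[i]]_d -> 'rV[R[i]]_d) (M1 : R).
Hypothesis chart1 : defining_chart al Om1 x rho1 r1 A1 M1.
Hypothesis bx : boundary Om1 x.
Variables (sig1 t1 : R) (tau1 : 'rV[R[i]]_d -> R -> 'rV[R[i]]_d).
Hypotheses (sig1_gt0 : 0 < sig1) (t1_gt0 : 0 < t1).
Hypothesis tau1_in : forall p t, cnorm (p - x) < sig1 -> 0 <= - r1 p -> - r1 p <= t ->
  0 < t -> t <= t1 -> Om1 (tau1 p t).
Hypothesis tau1_growth : forall p t h, cnorm (p - x) < sig1 -> 0 < - r1 p -> - r1 p <= t ->
  t <= t1 -> line_holomorphic Om1 h -> (forall z, Om1 z -> 0 < Re (h z)) ->
  cnorm (h (tau1 p t)) <= 2 * t / (- r1 p) * cnorm (h p).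
Hypothesis tau1_cont : forall t e, 0 < e -> exists2 del, 0 < del &
  forall p, cnorm (p - x) < del -> 0 <= - r1 p -> cnorm (tau1 p t - tau1 x t) < e.

Section charted.
Variables (y : 'rV[R[i]]_d) (rho2 : R) (r2 : 'rV[R[i]]_d -> R).
Variables (A2 : 'rV[R[i]]_d -> 'rV[R[i]]_d) (M2 : R).
Hypothesis chart2 : defining_chart al Om2 y rho2 r2 A2 M2.
Hypothesis by_ : boundary Om2 y.

(* Hopf lemma for f^-1: apply the growth estimate of Om2 at f p to a
   supporting functional of Om1 at a boundary point near p, composed with g. *)
Lemma hopf_estimate : exists2 C, 0 <= C & exists2 del, 0 < del &
  forall p, Om1 p -> cnorm (p - x) < del -> cnorm (f p - y) < del ->
    - r2 (f p) <= C * - r1 p.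
Proof.
have rho10 := chart_rho_gt0 chart1; have rho20 := chart_rho_gt0 chart2.
have rx0 : r1 x = 0 by apply/(chart_boundary chart1 (chart_center chart1)).
have ry0 : r2 y = 0 by apply/(chart_boundary chart2 (chart_center chart2)).
have [sig2 [t2 [tau2 [/andP[sig20 sig2r] t20 tau2_in tau2_growth tau2_cont]]]] :=
  chart_growth al0 al1 chart2 ry0.
have [C1 C10 foot1] := chart_foot al0 chart1 rx0.
have [B1 B10 bound1] := chart_gradient_bound al0 chart1.
(* A reference point of [Om2] at fixed depth over [y]. Its image under [g] is interior to [Om1], so
   the functional at [x] has there a fixed size [k]; for [P] near [y] and [b] near [x] at least
   [k / 2] remains. *)
pose Q := tau2 y t2.
have OQ : Om2 Q by apply: tau2_in; rewrite ?subrr ?cnorm0 ?ry0 ?oppr0 ?lexx ?(ltW t20).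
have OG := g21 OQ; set G := g Q in OG.
pose k := - Re (cdot (A1 x) (G - x)).
have k0 : 0 < k by rewrite oppr_gt0; exact: (chart_supporting al0 chart1 oOm1 cOm1 (chart_center chart1) bx OG).
have k20 : 0 < k / 2 by exact: divr_gt0.
have [da da0 Ha] := chart_functional_limit al0 chart1 G (chart_center chart1) k20.
have [db db0 Hb] := holomorphic_eps gh OQ da0.
have [dc dc0 Hc] := tau2_cont t2 db db0.
have [dd dd0 Hd] := foot1 da da0.
have [de de0 He] := chart_continuous al0 chart2 ry0 t20.
(* Obtained by solving for [- r2 P] in [k / 2 <= 2 * t2 / (- r2 P) * (B1 * (C1 * - r1 p))]. *)
exists (2 * t2 * (B1 * C1) / (k / 2)).
  by rewrite divr_ge0 ?(ltW k20)// !mulr_ge0 ?(ltW t20).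
exists (Num.min (Num.min dd rho1) (Num.min (Num.min dc de) (Num.min sig2 rho2))).
  by rewrite !lt_min dd0 rho10 dc0 de0 sig20 rho20.
move=> p Op; rewrite !lt_min => /andP[/andP[pd pr] _] /andP[_ /andP[/andP[Pc Pe] /andP[Ps Pr]]].
have OP := f12 Op; set P := f p in OP Pc Pe Ps Pr *.
have r1p : r1 p < 0 by apply/(chart_inside chart1 pr).
have r2P : r2 P < 0 by apply/(chart_inside chart2 Pr).
have s2 : 0 < - r2 P by rewrite oppr_gt0.
have [b [bd bin bb pb]] := Hd p pd (ltW r1p).
have st : - r2 P <= t2 by apply/ltW; apply: le_lt_trans (He P Pe); rewrite -normrN; exact: ler_norm.
have pos z : Om2 z -> 0 < Re (cdot (- A1 b) (g z - b)).
  move=> Oz; rewrite cdotNl cReN oppr_gt0.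
  exact: (chart_supporting al0 chart1 oOm1 cOm1 bin bb (g21 Oz)).
have := tau2_growth P t2 _ Ps s2 st (lexx _) (@line_holomorphic_functional R d Om2 g gh (- A1 b) b) pos.
rewrite {3}/P fK// !cdotNl !cnormN => grow.
have low : k / 2 <= cnorm (cdot (A1 b) (g (tau2 P t2) - b)).
  have h1 := Ha b (g (tau2 P t2)) bd (Hb _ (Hc P Pc (ltW s2))).
  have h2 : k <= cnorm (cdot (A1 x) (G - x)).
    by apply: le_trans (Re_le_cnorm _); rewrite -normrN; exact: ler_norm.
  have := cnormBr (cdot (A1 x) (G - x)) (cdot (A1 x) (G - x) - cdot (A1 b) (g (tau2 P t2) - b)).
  rewrite subKr cdistrC => h3.
  apply: le_trans h3; rewrite lerBrDr; apply: le_trans _ h2.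
  by rewrite [leRHS]splitr lerD2l.
have up : cnorm (cdot (A1 b) (p - b)) <= B1 * (C1 * - r1 p).
  by apply: le_trans (bound1 _ _ bin) _; apply: ler_wpM2l.
have q0 : 0 <= 2 * t2 / - r2 P by rewrite divr_ge0 ?(ltW s2)// mulr_ge0 ?(ltW t20).
have := le_trans low (le_trans grow (ler_wpM2l q0 up)).
rewrite mulrAC ler_pdivlMr// => h.
rewrite mulrAC ler_pdivlMr// mulrC; apply: le_trans h _.
by rewrite !mulrA.
Qed.

(** The curve [tau1 x] is a parameter of the section, fixed before [y]; only the constant depends on
    [y], so one curve tests all cluster values at [x]. *)
Lemma cluster_value_decay : cluster_value Om1 f x y ->
  exists2 C, 0 <= C & forall t, 0 < t -> t <= t1 ->
    cnorm (cdot (A2 y) (f (tau1 x t) - y)) <= C * t.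
Proof.
move=> cy; have rho10 := chart_rho_gt0 chart1; have rho20 := chart_rho_gt0 chart2.
have rx0 : r1 x = 0 by apply/(chart_boundary chart1 (chart_center chart1)).
have ry0 : r2 y = 0 by apply/(chart_boundary chart2 (chart_center chart2)).
have [H H0 [dh dh0 hopf]] := hopf_estimate.
have [C2 C20 foot2] := chart_foot al0 chart2 ry0.
have [B2 B20 bound2] := chart_gradient_bound al0 chart2.
(* The factors come from the growth estimate, the bound on the gradient, the distance to the foot
   point and the Hopf estimate; the depth [- r1 p] cancels. *)
exists (2 * (B2 * (C2 * H))); first by rewrite !mulr_ge0.
move=> t tgt0 tt1; apply/ler_addgt0Pr => e e0.
have OW : Om1 (tau1 x t) by apply: tau1_in; rewrite ?subrr ?cnorm0 ?rx0 ?oppr0 ?lexx ?(ltW tgt0).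
(* Here [t] is fixed while [p] tends to [x]: [e] absorbs the replacement of [b] by [y] and of
   [tau1 p t] by [tau1 x t]. *)
have [d1 d10 Hd1] := chart_functional_limit al0 chart2 (f (tau1 x t)) (chart_center chart2) e0.
have [d2 d20 Hd2] := holomorphic_eps fh OW d10.
have [d3 d30 Hd3] := tau1_cont t d20.
have [d4 d40 Hd4] := foot2 d1 d10.
have [d5 d50 Hd5] := chart_continuous al0 chart1 rx0 tgt0.
pose del := Num.min (Num.min (Num.min dh d3) (Num.min d4 d5)) (Num.min (Num.min rho1 rho2) sig1).
have del0 : 0 < del by rewrite !lt_min dh0 d30 d40 d50 rho10 rho20.
have [p [Op]] := cy del del0; rewrite !lt_min.
move=> /andP[/andP[/andP[ph p3] /andP[_ p5]] /andP[/andP[pr _] ps]].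
move=> /andP[/andP[/andP[Ph _] /andP[P4 _]] /andP[/andP[_ Pr] _]].
have OP := f12 Op.
have r1p : r1 p < 0 by apply/(chart_inside chart1 pr).
have r2P : r2 (f p) < 0 by apply/(chart_inside chart2 Pr).
have s1 : 0 < - r1 p by rewrite oppr_gt0.
have [b [bd bin bb pb]] := Hd4 (f p) P4 (ltW r2P).
have st : - r1 p <= t by apply/ltW; apply: le_lt_trans (Hd5 p p5); rewrite -normrN; exact: ler_norm.
have pos z : Om1 z -> 0 < Re (cdot (- A2 b) (f z - b)).
  move=> Oz; rewrite cdotNl cReN oppr_gt0.
  exact: (chart_supporting al0 chart2 oOm2 cOm2 bin bb (f12 Oz)).
have := tau1_growth ps s1 st tt1 (@line_holomorphic_functional R d Om1 f fh (- A2 b) b) pos.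
rewrite !cdotNl !cnormN => grow.
have up : cnorm (cdot (A2 b) (f p - b)) <= B2 * (C2 * (H * - r1 p)).
  apply: le_trans (bound2 _ _ bin) _; apply: ler_wpM2l => //.
  by apply: le_trans pb _; apply: ler_wpM2l => //; exact: hopf.
have q0 : 0 <= 2 * t / - r1 p by rewrite divr_ge0 ?(ltW s1)// mulr_ge0 ?(ltW tgt0).
have up2 := le_trans grow (ler_wpM2l q0 up).
have E : 2 * t / - r1 p * (B2 * (C2 * (H * - r1 p))) = 2 * (B2 * (C2 * H)) * t.
  by field; rewrite -oppr_eq0 lt0r_neq0.
rewrite E in up2.
have := Hd1 b (f (tau1 p t)) bd (Hd2 _ (Hd3 p p3 (ltW s1))).
rewrite cdistrC => lim.
rewrite -[cdot (A2 y) _](subrK (cdot (A2 b) (f (tau1 p t) - b))) addrC.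
by apply: le_trans (cnormD _ _) _; exact: lerD.
Qed.

End charted.
End at_boundary_points.
End cluster_values.

(** * Compactness and the extension *)

Section compactness.
Variables (R : realType) (d : nat).

Definition cbox (N : R) : set R[i] := [set z | `|Re z| <= N /\ `|Im z| <= N].

Lemma compact_cbox N : compact (cbox N).
Proof.
pose h (p : R * R) : R[i] := p.1 +i* p.2.
have hc : continuous h.
  move=> [a b] B hB; have [e e0 He] := (nbhs_cnormP (a +i* b) B).1 hB.
  have e2 : 0 < e / 2 by exact: divr_gt0.
  exists (ball a (e / 2), ball b (e / 2)); first by split; exact: nbhsx_ballx.
  move=> [a' b'] [/= ha hb]; apply: He; apply: le_lt_trans (cnorm_le_ReIm _) _.
  rewrite cReB cImB /= [e]splitr distrC [`|b' - b|]distrC.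
  by move: ha hb; rewrite -!ball_normE /= => ha hb; exact: ltrD.
have -> : cbox N = h @` (`[- N, N]%classic `*` `[- N, N]%classic).
  apply/seteqP; split => [z [zr zi]|_ [[a b] [/= ha hb] <-]].
    exists (Re z, Im z); last exact: complex_eq.
    by split; rewrite /= in_itv /= -ler_norml.
  by move: ha hb; rewrite !in_itv /= -!ler_norml.
apply: continuous_compact; first exact: continuous_subspaceT.
by apply: compact_setX; exact: segment_compact.
Qed.

Definition row_cbox (N : R) : set 'rV[R[i]]_d := [set v | forall j, cbox N (v 0 j)].

Lemma compact_row_cbox N : compact (row_cbox N).
Proof. by apply: (@rV_compact R[i] d (fun=> cbox N)) => _; exact: compact_cbox. Qed.

Lemma cnorm_row_cbox N v : cnorm v <= N -> row_cbox N v.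
Proof.
move=> vN j; split; apply: le_trans vN.
  exact: le_trans (Re_le_cnorm _) (cnorm_entry _ _).
exact: le_trans (Im_le_cnorm _) (cnorm_entry _ _).
Qed.

Lemma bounded_set_cnorm (Om : set 'rV[R[i]]_d) : bounded_set Om ->
  exists N : R, forall z, Om z -> cnorm z <= N.
Proof.
move=> [M [Mr HM]]; have ME : M = (Re M)%:C by rewrite RRe_real.
exists (Re M + 1) => z Oz; rewrite -lecR -cnormE; apply: HM Oz.
by rewrite ME ltcR ltrDl.
Qed.

Lemma bounded_cluster (T : Type) (F : set_system T) (FF : ProperFilter F)
    (h : T -> 'rV[R[i]]_d) (N : R) :
  F [set t | cnorm (h t) <= N] ->
  exists w, cluster (h @ F) w.
Proof.
move=> FN; have [|w [_ cw]] := compact_row_cbox (N := N) (F := h @ F) _.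
  by apply: filterS FN => t; exact: cnorm_row_cbox.
by exists w.
Qed.

Lemma cluster_cnorm (T : Type) (F : set_system T) (FF : ProperFilter F)
    (h : T -> 'rV[R[i]]_d) w : cluster (h @ F) w ->
  forall (A : set T) (e : R), F A -> 0 < e -> exists2 t, A t & cnorm (h t - w) < e.
Proof.
move=> cw A e FA e0.
have FhA : F (h @^-1` (h @` A)) by apply: filterS FA => t At; exists t.
have [||_ [[t At <-] tw]] := cw (h @` A) [set v | cnorm (v - w) < e].
- exact: FhA.
- by apply/nbhs_cnormP; exists e.
- by exists t.
Qed.

Lemma unique_cluster_cvg (T : Type) (F : set_system T) (FF : ProperFilter F)
    (h : T -> 'rV[R[i]]_d) (N : R) (l : 'rV[R[i]]_d) :
  F [set t | cnorm (h t) <= N] -> (forall w, cluster (h @ F) w -> w = l) -> h @ F --> l.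
Proof.
move=> FN Hl; have [l' cl'] := bounded_cluster FF FN.
have ll' := Hl _ cl'; rewrite ll' in cl'.
have lN : cnorm l <= N + 1.
  have [t tN tl] := cluster_cnorm FF cl' FN ltr01.
  by rewrite -[l](subKr (h t)); apply: le_trans (cnormB _ _) _; apply: lerD => //; exact: ltW.
(* The limit has norm at most [N + 1], so the box of size [N + 2] contains the unit ball around it
   and is a compact neighbourhood of it. *)
have N2 : N <= N + 2 by rewrite lerDl.
have FV : F (h @^-1` row_cbox (N + 2)).
  by apply: filterS FN => t tN; apply: cnorm_row_cbox; exact: le_trans N2.
apply: (@compact_cluster_set1 _ l (h @ F) (row_cbox (N + 2))).
- exact: norm_hausdorff.
- exact: compact_row_cbox.
- apply/nbhs_cnormP; exists 1 => // w wl; apply: cnorm_row_cbox.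
  rewrite -[w](subrK l); apply: le_trans (cnormD _ _) _; lra.
- exact: FV.
- by apply/seteqP; split => [w /Hl ->|_ ->].
Qed.

End compactness.

(** The complex hyperplane through [y] on which the functional is constant misses [Om], because even
    the real part is nonzero there; it is thus supporting, and both [y] and [w] lie in its one-point
    contact set. *)
Lemma strictly_convex_contact (R : realType) (d : nat) (Om : set 'rV[R[i]]_d) a y w :
  open Om -> Om !=set0 -> C_strictly_convex Om -> boundary Om y ->
  (forall z, Om z -> Re (cdot a (z - y)) < 0) ->
  closure Om w -> cdot a (w - y) = 0 -> w = y.
Proof.
move=> oOm [z0 Oz0] strict by_ neg cw wy.
pose H := [set z : 'rV[R[i]]_d | \sum_(j < d) a 0 j * z 0 j = cdot a y].
have HE z : cdot a (z - y) = 0 -> H z.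
  by rewrite cdotBr => /eqP; rewrite subr_eq0 => /eqP.
have HN z : H z -> cdot a (z - y) = 0.
  by rewrite cdotBr /H /= -/(cdot a z) => ->; rewrite subrr.
have nO z : H z -> ~ Om z by move=> /HN h /neg; rewrite h ltxx.
have Hy : H y by [].
have supp : supporting_complex_hyperplane Om H.
  split.
  - exists a, (cdot a y); split => //; apply/eqP => a0.
    have := neg z0 Oz0; rewrite a0 /cdot big1 ?ltxx// => j _.
    by rewrite mxE mul0r.
  - by exists y.
  - by apply/seteqP; split => // z [Hz Oz]; exact: (nO z Hz Oz).
have [x0 Hx0] := strict H supp.
have yx : y = x0 by have : (H `&` boundary Om) y by []; rewrite Hx0.
have Hw := HE w wy.
have [/(nO w Hw)//|bw] := closure_openP oOm cw.
by have : (H `&` boundary Om) w by []; rewrite Hx0 yx.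
Qed.

Theorem corollary2p19 (R : realType) (d : nat) (alpha : R)
    (Om1 Om2 : set 'rV[R[i]]_d)
    (alpha_gt0 : 0 < alpha) (alpha_le1 : alpha <= 1)
    (dom1 : bounded_convex_domain Om1) (dom2 : bounded_convex_domain Om2)
    (reg1 : C1holder_boundary alpha Om1) (reg2 : C1holder_boundary alpha Om2)
    (strict2 : C_strictly_convex Om2)
    (f : 'rV[R[i]]_d -> 'rV[R[i]]_d) (bihol_f : biholomorphism Om1 Om2 f) :
  exists fbar : 'rV[R[i]]_d -> 'rV[R[i]]_d,
    [/\ {within closure Om1, continuous fbar},
        fbar @` closure Om1 `<=` closure Om2 &
        forall z, Om1 z -> fbar z = f z].
Proof.
have [_ oOm1 cOm1 _] := dom1; have [ne2 oOm2 cOm2 bOm2] := dom2.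
have [fh [ffun _ fsurj] [g gh fK]] := bihol_f.
have f12 z : Om1 z -> Om2 (f z) by exact: ffun.
have g21 w : Om2 w -> Om1 (g w) by move=> /fsurj[z Oz <-]; rewrite fK.
have [N HN] := bounded_set_cnorm bOm2.
(* Approach from inside [Om1] only: the values of [f] elsewhere are arbitrary. *)
pose F (x : 'rV[R[i]]_d) := within Om1 (nbhs x).
have FP x : closure Om1 x -> ProperFilter (F x).
  move=> cx; apply: within_nbhs_proper; exact: cx.
have FN x : F x [set p | cnorm (f p) <= N].
  by apply/nbhs_cnormP; exists 1 => // p _ Op; apply: HN; exact: f12.
have clus x y : closure Om1 x -> cluster (f @ F x) y -> cluster_value Om1 f x y.
  move=> /FP Fx cy e e0; have Fe : F x [set p | Om1 p /\ cnorm (p - x) < e].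
    by apply/nbhs_cnormP; exists e.
  by have [p [Op px] py] := cluster_cnorm Fx cy Fe e0; exists p.
have unique x y y' : boundary Om1 x -> cluster_value Om1 f x y -> cluster_value Om1 f x y' -> y = y'.
  move=> bx cy cy'.
  have [rho1 [r1 [A1 [M1 chart1]]]] := C1holder_chart alpha_gt0 reg1 bx.
  have rx0 : r1 x = 0 by apply/(chart_boundary chart1 (chart_center chart1)).
  have [sig [t1 [tau [/andP[sig0 _] t10 tin tgrow tcont]]]] :=
    chart_growth alpha_gt0 alpha_le1 chart1 rx0.
  have Ot t : 0 < t -> t <= t1 -> Om1 (tau x t).
    by move=> t0 tt; apply: tin; rewrite ?subrr ?cnorm0 ?rx0 ?oppr0 ?lexx ?(ltW t0).
  have Ft : (0 : R)^'+ [set t | 0 < t /\ t <= t1].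
    near=> t; split; first by near: t; exact: nbhs_right_gt.
    by near: t; exact: nbhs_right_le.
  have FtN : (0 : R)^'+ [set t | cnorm (f (tau x t)) <= N].
    by apply: filterS Ft => t [t0 tt]; apply: HN; apply: f12; exact: Ot.
  (* A cluster point [w] along the curve is fixed once; proving it equal to an arbitrary cluster
     value identifies [y] with [y']. *)
  have [w cw] := bounded_cluster _ FtN.
  have closw : closure Om2 w.
    apply/closure_cnormP => e e0; have [t [t0 tt] tw] := cluster_cnorm _ cw Ft e0.
    by exists (f (tau x t)) => //; apply: f12; exact: Ot.
  suff main z : cluster_value Om1 f x z -> w = z by rewrite -(main y cy) (main y' cy').
  move=> cz; have bz := cluster_value_boundary oOm1 oOm2 gh f12 g21 fK bx cz.
  have [rho2 [r2 [A2 [M2 chart2]]]] := C1holder_chart alpha_gt0 reg2 bz.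
  have [C C0 decay] := cluster_value_decay alpha_gt0 alpha_le1 oOm1 cOm1 oOm2 cOm2 fh gh
    f12 g21 fK chart1 bx sig0 tin tgrow tcont chart2 bz cz.
  apply: (strictly_convex_contact oOm2 ne2 strict2 bz _ closw (a := A2 z)).
    by move=> u Ou; exact: (chart_supporting alpha_gt0 chart2 oOm2 cOm2 (chart_center chart2) bz Ou).
  apply/eqP; rewrite -cnorm_eq0 eq_le cnorm_ge0 andbT; apply/ler_addgt0Pr => e e0; rewrite add0r.
  (* Both the decay [C * t] and the error of approximating [w] are taken at scale [e / D]; the added
     1 only makes [D] positive. *)
  pose D := d%:R * cnorm (A2 z) + C + 1.
  have D0 : 0 < D.
    by rewrite ltr_wpDl// addr_ge0// mulr_ge0// cnorm_ge0.
  have q0 : 0 < e / D by exact: divr_gt0.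
  have Fq : (0 : R)^'+ [set t | (0 < t /\ t <= t1) /\ t <= e / D].
    apply: filterI => //; near=> t; by near: t; exact: nbhs_right_le.
  have [t [[t0 tt] tq] tw] := cluster_cnorm _ cw Fq q0.
  have -> : cdot (A2 z) (w - z) = cdot (A2 z) (f (tau x t) - z) - cdot (A2 z) (f (tau x t) - w).
    by rewrite !cdotBr opprB [RHS]addrC addrA subrK.
  apply: le_trans (cnormB _ _) _.
  apply: le_trans (lerD (decay t t0 tt) (cnorm_cdot _ _)) _.
  have h1 : C * t <= C * (e / D) by exact: ler_wpM2l.
  have h2 : d%:R * cnorm (A2 z) * cnorm (f (tau x t) - w) <= d%:R * cnorm (A2 z) * (e / D).
    by apply: ler_wpM2l; [rewrite mulr_ge0// cnorm_ge0|exact: ltW].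
  apply: le_trans (lerD h1 h2) _; rewrite -mulrDl mulrA ler_pdivrMr// mulrC ler_pM2l//.
  by rewrite /D addrC lerDl.
(* One choice covers interior points, where the limit is [f x] by continuity, and boundary points,
   where uniqueness of the cluster value gives it; outside the closure the value is the default
   0. *)
have /choice[fbar Hf] : forall x, exists l, closure Om1 x -> f @ F x --> l /\ (Om1 x -> l = f x).
  move=> x; have [cx|] := pselect (closure Om1 x); last by exists 0.
  have Fx := FP x cx.
  have [Ox|bx] := closure_openP oOm1 cx.
    exists (f x) => _; split; last by [].
    have fc := differentiable_continuous (fh x Ox).
    by apply: cvg_trans fc; apply: cvg_app; exact: cvg_within.
  have [l cl] := bounded_cluster Fx (FN x).
  exists l => _; split; last by move=> Ox; have /(boundary_openP x oOm1)[] := bx.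
  apply: (unique_cluster_cvg Fx (FN x)) => w cw.
  by apply: (unique x) => //; exact: clus.
have Hlim x e : closure Om1 x -> 0 < e -> exists2 del, 0 < del &
    forall p, Om1 p -> cnorm (p - x) < del -> cnorm (f p - fbar x) < e.
  move=> cx e0; have [lx _] := Hf x cx.
  have B : nbhs (fbar x) [set v | cnorm (v - fbar x) < e] by apply/nbhs_cnormP; exists e.
  have /nbhs_cnormP[del del0 H] := lx _ B; exists del => // p Op px; exact: H px Op.
exists fbar; split.
- apply/subspace_continuousP => x cx B /nbhs_cnormP[e e0 He].
  have e2 : 0 < e / 2 by exact: divr_gt0.
  have [del del0 H] := Hlim x (e / 2) cx e2.
  apply/nbhs_cnormP; exists del => // w wx cw; apply: He.
  have [del' del'0 H'] := Hlim w (e / 2) cw e2.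
  (* The second bound keeps the approximating point [p] within [del] of [x], so [f p] is close to
     both [fbar w] and [fbar x]. *)
  have m0 : 0 < Num.min del' (del - cnorm (w - x)) by rewrite lt_min del'0 subr_gt0.
  have [p Op] := (closure_cnormP _ _).1 cw _ m0; rewrite lt_min => /andP[p1 p2].
  have -> : fbar w - fbar x = (f p - fbar x) - (f p - fbar w).
    by rewrite opprB [RHS]addrC addrA subrK.
  apply: le_lt_trans (cnormB _ _) _; rewrite [e]splitr; apply: ltrD; last exact: H'.
  apply: H => //; rewrite -[p - x](subrK (w - x)) (_ : p - x - (w - x) = p - w).
    by apply: le_lt_trans (cnormD _ _) _; rewrite -ltrBrDr.
  by rewrite opprB addrA subrK.
- move=> _ [x cx <-]; apply/closure_cnormP => e e0.
  have [del del0 H] := Hlim x e cx e0.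
  have [p Op px] := (closure_cnormP _ _).1 cx del del0.
  by exists (f p); [exact: f12|exact: H].
- by move=> z Oz; have [_ ->] := Hf z (subset_closure Oz).
Unshelve. all: by end_near. Qed.
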